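(* Let $X_1,\dots,X_n$ be independent random operators taking values in the compact self-adjoint operators on $\mathbb{H}$, with $\mathbb{E}X_i=0$ for all $i$, and let $S_i:=\sum_{j\le i}X_j$. Let $\psi:[0,\theta_{\max})\to\mathbb{R}$ be CGF-like, and let $\sigma>0$, $d'\ge 1$, $r\ge 0$. (a) If $$\mathbb{E}\,\mathrm{tr}(\phi(\theta S_n))+d'\le d'\exp\left(\psi(|\theta|)\sigma^2\right)\qquad(\ast)$$ holds for every $\theta\in[0,\theta_{\max})$, then $$\mathbb{P}\left(\sup_{i\le n}\lambda_{\max}(S_i)\ge r\right)\le \frac{e}{e-1}\,d'\left[\inf_{\theta\in[0,\theta_{\max})}\exp\left(\psi(\theta)\sigma^2-\theta r\right)\right].$$ (b) If $(\ast)$ holds for every $\theta\in(-\theta_{\max},\theta_{\max})$, or if the inequality obtained from $(\ast)$ by replacing $\phi$ with $\varphi$ holds for every $\theta\in(-\theta_{\max},\theta_{\max})$, then $$\mathbb{P}\left(\sup_{i\le n}\|S_i\|\ge r\right)\le 2d'\left[\inf_{\theta\in[0,\theta_{\max})}\exp\left(\psi(\theta)\sigma^2-\theta r\right)\right].$$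
   Context: $\mathbb{H}$ is a separable real or complex Hilbert space (possibly infinite-dimensional). For a self-adjoint compact operator $A$, $\lambda_{\max}(A)$ and $\lambda_{\min}(A)$ denote the maximum and minimum of its spectrum, $\|A\|=\max(-\lambda_{\min}(A),\lambda_{\max}(A))$ is the operator norm, $\mathrm{tr}$ is the trace (taking values in $[0,\infty]$ on positive semidefinite operators), and $f(A)$ is defined by spectral calculus for $f:\mathbb{R}\to\mathbb{R}$. The functions $\phi,\varphi$ are $\phi(u)=e^u-u-1$ and $\varphi(u)=\cosh(u)-1$. A function $\psi:[0,\theta_{\max})\to\mathbb{R}$, with $\theta_{\max}\in(0,\infty]$, is CGF-like if it is strictly convex and twice continuously differentiable with $\psi(0)=\psi'_+(0)=0$ and $\sup_{\theta\in[0,\theta_{\max})}\psi(\theta)=\infty$. *)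

(* Defs.v *)
From HB Require Import structures.
From mathcomp Require Import all_boot all_order all_algebra sesquilinear.
From mathcomp Require Import all_classical all_reals all_analysis.
From mathcomp.real_closed Require Import complex.

Set Implicit Arguments.
Unset Strict Implicit.
Unset Printing Implicit Defensive.
Import Order.TTheory GRing.Theory Num.Theory numFieldNormedType.Exports.

Local Open Scope classical_set_scope.
Local Open Scope ring_scope.

(* The scalar field of a Hilbert space is either R or R[i]. *)
Inductive scalar_kind := RealScalars | ComplexScalars.

Definition scalar (R : realType) (k : scalar_kind) : numFieldType :=
  match k with
  | RealScalars => (R : numFieldType)
  | ComplexScalars => (R[i] : numFieldType)
  end.

Section Scalars.
Context {R : realType} {k : scalar_kind}.

Definition sconj : scalar R k -> scalar R k :=
  match k with
  | RealScalars => idfun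
  | ComplexScalars => @conjc R
  end.

Definition sre : scalar R k -> R :=
  match k with
  | RealScalars => idfun
  | ComplexScalars => @complex.Re R
  end.

Definition sim : scalar R k -> R :=
  match k with
  | RealScalars => cst 0
  | ComplexScalars => @complex.Im R
  end.

Definition sreal : R -> scalar R k :=
  match k with
  | RealScalars => idfun
  | ComplexScalars => fun x => Complex x 0
  end.

End Scalars.

(* The inner product is linear in its first argument and conjugate-linear in
   its second one; completeness is that of the underlying normed module. *)
Record hilbertSpace (R : realType) (k : scalar_kind) := HilbertSpace {
  hilbert_sort :> completeNormedModType (scalar R k) ;
  inner : {dot hilbert_sort for (@sconj R k)} ;
  inner_norm : forall u : hilbert_sort, `|u| ^+ 2 = inner u u
}.

Definition separable (T : topologicalType) : Prop :=
  exists2 D : set T, countable D & dense D.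

Section Operators.
Context {R : realType} {k : scalar_kind} {H : hilbertSpace R k}.
Implicit Types (A B : H -> H) (u v e : H) (E : set H).

Definition bounded_operator A : Prop := linear A /\ continuous A.

Definition compact_selfadjoint : set (H -> H) :=
  [set A | [/\ linear A,
    precompact (A @` [set u | `|u| <= 1]) &
    forall u v, inner H (A u) v = inner H u (A v)]].

Definition opnorm A : R := sup [set sre `|A u| | u in [set u | `|u| <= 1]].

Definition spectrum A : set (scalar R k) :=
  [set z | ~ exists B, [/\ bounded_operator B,
    forall u, B (A u - z *: u) = u & forall u, A (B u) - z *: B u = u]].

(* The spectrum of a self-adjoint operator consists of real scalars; if the
   operator is moreover compact and H <> 0, then this spectrum is compact and
   nonempty, so that the supremum below is a maximum. On the zero space the
   spectrum is empty and lambda_max is 0. *)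
Definition lambda_max A : R := sup [set t : R | spectrum A (sreal t)].

(* In a complete space a maximal orthonormal set has a dense span. *)
Definition orthonormal_basis E : Prop :=
  [/\ forall e, E e -> inner H e e = 1,
      forall e e', E e -> E e' -> e <> e' -> inner H e e' = 0 &
      forall u, (forall e, E e -> inner H u e = 0) -> u = 0].

(* A = \sum_e (l e) e (x) e and B = \sum_e f (l e) e (x) e for some orthonormal
   basis of eigenvectors of A. This determines B, independently of the chosen
   basis, because B is bounded and prescribed on each eigenspace of A. *)
Definition spectral_fun (f : R -> R) A B : Prop :=
  bounded_operator B /\
  exists (E : set H) (l : H -> R), orthonormal_basis E /\
    forall e, E e -> A e = sreal (l e) *: e /\ B e = sreal (f (l e)) *: e.

(* Such a B exists when A is compact self-adjoint and f is bounded on bounded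
   sets. *)
Definition opfun (f : R -> R) A : H -> H :=
  xget (fun=> 0) [set B | spectral_fun f A B].

(* The trace of a positive semidefinite operator (its value does not depend on
   the basis); esum is a supremum of finite partial sums, and is only meaningful
   here when all the terms are nonnegative. *)
Definition optrace B : \bar R :=
  \esum_(e in xget set0 orthonormal_basis) (sre (inner H (B e) e))%:E.

(* The topology of the operator norm on the space of compact self-adjoint
   operators, and its Borel sets. A set of this family may contain arbitrary
   functions outside compact_selfadjoint: only its intersection with this space
   matters. *)
Definition op_open : set (set (H -> H)) :=
  [set U | forall A, compact_selfadjoint A -> U A ->
     exists2 eps : R, 0 < eps & forall B, compact_selfadjoint B ->
       opnorm (B - A) < eps -> U B].

Definition op_borel : set (set (H -> H)) := <<s op_open >>.

End Operators.

Section RandomOperators.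
Context {R : realType} {k : scalar_kind} {H : hilbertSpace R k}.
Context {d : measure_display} {Omega : measurableType d}.

Definition random_operator (X : Omega -> H -> H) : Prop :=
  (forall w, compact_selfadjoint (X w)) /\
  (forall B, op_borel B -> measurable (X @^-1` B)).

Definition independent_operators (P : probability Omega R) (n : nat)
    (X : 'I_n -> Omega -> H -> H) : Prop :=
  forall (J : {set 'I_n}) (B : 'I_n -> set (H -> H)),
    (forall i, i \in J -> op_borel (B i)) ->
    P (\bigcap_(i in [set` J]) (X i @^-1` B i)) =
    (\prod_(i in J) P (X i @^-1` B i))%E.

(* The weak expectation: M = E X means <M u, v> = E <X u, v> for all u, v. It is
   implied by the Bochner expectation, of which it requires only the matrix
   coefficients. *)
Definition has_expectation (P : probability Omega R)
    (X : Omega -> H -> H) (M : H -> H) : Prop :=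
  forall u v : H,
    [/\ P.-integrable setT (fun w => (sre (inner H (X w u) v))%:E),
        P.-integrable setT (fun w => (sim (inner H (X w u) v))%:E),
        (\int[P]_w (sre (inner H (X w u) v))%:E)%E =
          (sre (inner H (M u) v))%:E &
        (\int[P]_w (sim (inner H (X w u) v))%:E)%E =
          (sim (inner H (M u) v))%:E].

(* X is indexed from 0: partial_sum X i is the sum of its first i terms. *)
Definition partial_sum (n : nat) (X : 'I_n -> Omega -> H -> H) (i : nat)
    (w : Omega) : H -> H :=
  \sum_(j < n | (j < i)%N) X j w.

End RandomOperators.

Section CGF.
Context {R : realType}.
Implicit Types (psi : R -> R) (thmax : \bar R) (t : R).

Definition phi (u : R) : R := expR u - u - 1.

Definition cosh (u : R) : R := (expR u + expR (- u)) / 2.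

Definition varphi (u : R) : R := cosh u - 1.

Definition cgf_dom thmax : set R := [set t | 0 <= t /\ (t%:E < thmax)%E].

(* f' is the derivative of f on D: the limit of the difference quotients is
   taken within D, hence it is one-sided at an end point of D. *)
Definition derivative_on (D : set R) (f f' : R -> R) : Prop :=
  forall t, D t -> (f s - f t) / (s - t) @[s --> within D t^'] --> f' t.

(* Only the values of psi on [0, thmax) matter. *)
Definition CGF_like thmax psi : Prop :=
  [/\ (0 < thmax)%E,
      forall x y a, cgf_dom thmax x -> cgf_dom thmax y -> x <> y ->
        0 < a -> a < 1 ->
        psi (a * x + (1 - a) * y) < a * psi x + (1 - a) * psi y,
      exists psi1 psi2 : R -> R,
        [/\ derivative_on (cgf_dom thmax) psi psi1,
            derivative_on (cgf_dom thmax) psi1 psi2,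
            {within cgf_dom thmax, continuous psi2},
            psi 0 = 0 & psi1 0 = 0] &
      ereal_sup [set (psi t)%:E | t in cgf_dom thmax] = +oo%E].

End CGF.

(* E tr (f (theta S)) + d' <= d' exp (psi |theta| sigma^2). *)
Definition trace_cgf_bound (R : realType) (k : scalar_kind)
    (H : hilbertSpace R k) (d : measure_display) (Omega : measurableType d)
    (P : probability Omega R) (f : R -> R) (psi : R -> R) (sigma d' : R)
    (S : Omega -> H -> H) (theta : R) : Prop :=
  (\int[P]_w optrace (opfun f (sreal theta *: S w)) + d'%:E <=
     (d' * expR (psi `|theta| * sigma ^+ 2))%:E)%E.

(* Main.v *)
Require Import Defs.
From HB Require Import structures.
From mathcomp Require Import all_boot all_order all_algebra.
From mathcomp Require Import all_classical all_reals all_analysis.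
From mathcomp.real_closed Require Import complex.
From mathcomp Require Import sesquilinear ring lra measurable_realfun.
(* Imported again so that [scalar] denotes the scalar field, not a linear form. *)
Require Import Defs.

Set Implicit Arguments.
Unset Strict Implicit.
Unset Printing Implicit Defensive.
Import Order.TTheory GRing.Theory Num.Theory numFieldNormedType.Exports.

Local Open Scope classical_set_scope.
Local Open Scope ring_scope.

(** The idea is to run the argument for Doob's maximal inequality on the scalar
    random walks [<S_i u, u>] rather than on the operators. For a unit vector
    [u] and a nonnegative convex [f], Jensen's inequality for the spectral
    measure of [A] at [u] gives [f (<A u, u>) <= <f(A) u, u> <= tr f(A)]
    ([optrace_ge]). So [tr f(theta S_n)] dominates [f (theta <S_n u, u>)] for
    all unit vectors [u] at the same time, and in particular for a vector that
    is selected at the random time when some walk first exceeds a level [y].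
    At this time the past is frozen; the remaining steps are centred and
    independent of it, and the tangent line of [f] at [theta y] bounds
    [f (theta <S_n u, u>)] from below by an affine function, whose integral is
    thus at least [f (theta y)] times the probability of the event
    ([maximal_inequality]). Countably many vectors suffice, as [H] is
    separable, and this also settles all questions of measurability.

    The link with the events of the theorem is that, unless [H] is zero,
    [lambda_max A] is the supremum of [<A u, u>] over unit vectors and
    [opnorm A] that of [|<A u, u>|] ([lambda_max_gt], [opnorm_gt]). Both cases
    are then instances of one statement about signed forms
    [sg m * <A v_m, v_m>] ([sup_event_moment]): it gives [p phi (theta r) <= d' (exp v - 1)] for the
    first probability [p], where [v] is [psi theta sigma^2], and
    [p varphi (theta r) <= d' (exp v - 1)] for the second one; there the
    hypothesis on [phi] at [theta] and [- theta] is first averaged, by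
    [phi x + phi (- x) = 2 varphi x].

    It remains to compare [(exp v - 1) / phi u] with [C exp (v - u)] for
    [u = theta r] and [C = e / (e - 1)]. If [C exp (v - u) >= 1] the bound is
    trivial because [d' >= 1]; otherwise the comparison reduces to
    [u exp (- u) <= 1 / e] ([phi_ratio]), and for [varphi] with [C = 2] to
    [exp (- 2 u) >= 0] ([varphi_ratio]). This holds for each [theta], so the
    infimum may be taken at the end ([tail_bound]).

    On the operator side, the functional calculus rests on the spectral theorem
    ([spectral_theorem]), obtained from a maximal orthonormal set of
    eigenvectors, and on the exponential series ([spectral_fun_exp]). *)

(** * Scalars *)

Section Scalars.
Context {R : realType} {k : scalar_kind}.
Implicit Types (z w : scalar R k) (a b : R).

Lemma sreD z w : sre (z + w) = sre z + sre w.
Proof. by case: k z w => //= -[? ?] [? ?]. Qed.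
Lemma sreN z : sre (- z) = - sre z.
Proof. by case: k z => //= -[? ?]. Qed.
Lemma sre0 : sre (0 : scalar R k) = 0.
Proof. by case: k. Qed.
Lemma sre_sum I (s : seq I) (f : I -> scalar R k) :
  sre (\sum_(i <- s) f i) = \sum_(i <- s) sre (f i).
Proof. by apply: (big_morph _ sreD sre0). Qed.
Lemma sre_conj z : sre (sconj z) = sre z.
Proof. by case: k z => //= -[? ?]. Qed.
Lemma sre_realM a z : sre (sreal a * z) = a * sre z.
Proof. by case: k z => //= -[? ?] /=; rewrite mul0r subr0. Qed.
Lemma sre_real a : sre (sreal a : scalar R k) = a.
Proof. by case: k. Qed.
Lemma sreal0 : sreal 0 = 0 :> scalar R k.
Proof. by case: k. Qed.
Lemma sreal1 : sreal 1 = 1 :> scalar R k.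
Proof. by case: k. Qed.
Lemma srealN a : sreal (- a) = - sreal a :> scalar R k.
Proof. by case: k => //=; rewrite /GRing.opp/= oppr0. Qed.
Lemma srealD a b : sreal (a + b) = sreal a + sreal b :> scalar R k.
Proof. by case: k => //=; rewrite /GRing.add/= addr0. Qed.
Lemma srealM a b : sreal (a * b) = sreal a * sreal b :> scalar R k.
Proof. by case: k => //=; rewrite /GRing.mul/= !(mul0r,mulr0,subr0,addr0). Qed.
Lemma sreal_conj a : sconj (sreal a : scalar R k) = sreal a.
Proof. by case: k => //=; rewrite oppr0. Qed.
Lemma sreal_lt a b : (sreal a < sreal b :> scalar R k) = (a < b).
Proof. by case: k => //=; rewrite ltcR. Qed.
Lemma sreal_le a b : (sreal a <= sreal b :> scalar R k) = (a <= b).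
Proof. by case: k => //=; rewrite lecR. Qed.
Lemma ge0_sreal z : 0 <= z -> z = sreal (sre z).
Proof. by case: k z => //= -[x y]; rewrite lecE/= => /andP[/eqP<-]. Qed.
Lemma sreal_norm a : `|sreal a : scalar R k| = sreal `|a|.
Proof. by case: k => //=; rewrite normc_def/= expr0n/= addr0 sqrtr_sqr. Qed.

Definition sqmod z : R := sre z ^+ 2 + sim z ^+ 2.
Lemma sqmod_ge0 z : 0 <= sqmod z.
Proof. by rewrite addr_ge0 ?sqr_ge0. Qed.
Lemma sqmod_eq0 z : sqmod z = 0 -> z = 0.
Proof.
rewrite /sqmod => /eqP; rewrite paddr_eq0 ?sqr_ge0// !sqrf_eq0.
by case: k z => /= [z /andP[/eqP]|[x y] /andP[/eqP/= -> /eqP ->]].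
Qed.
Lemma mul_conj z : z * sconj z = sreal (sqmod z).
Proof.
rewrite /sqmod; case: k z => /= [z|[x y]]; first by rewrite expr0n addr0 expr2.
by rewrite /GRing.mul/=; congr Complex; ring.
Qed.
Lemma sqmod_norm z : sqmod z = (sre `|z|) ^+ 2.
Proof.
rewrite /sqmod; case: k z => /= [z|[x y]]; first by rewrite expr0n addr0 -normrX ger0_norm ?sqr_ge0.
by rewrite sqr_sqrtr // addr_ge0 ?sqr_ge0.
Qed.

End Scalars.

(** * The underlying real inner product *)

(** The quadratic polynomial is evaluated at its minimizer [- b / c]; when [c = 0],
    an affine function that is bounded below is constant. *)
Lemma discr_le (R : realType) (a b c : R) : 0 <= c ->
  (forall t, 0 <= a + 2 * t * b + t ^+ 2 * c) -> b ^+ 2 <= a * c.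
Proof.
move=> c_ge0 h; have [c0|c0] := eqVneq c 0.
  have [->|b0] := eqVneq b 0; first by rewrite c0 expr0n mulr0.
  have := h (- (a + 1) / (2 * b)); rewrite c0 mulr0 addr0.
  have -> : a + 2 * (- (a + 1) / (2 * b)) * b = -1 by field.
  by rewrite ler0N1.
have := h (- b / c); have -> : a + 2 * (- b / c) * b + (- b / c) ^+ 2 * c =
  (a * c - b ^+ 2) / c by field.
by rewrite pmulr_lge0 ?subr_ge0// invr_gt0 lt_neqAle eq_sym c0.
Qed.

Section Geometry.
Context {R : realType} {k : scalar_kind} {H : hilbertSpace R k}.
Implicit Types (u v w : H) (a b : R) (z : scalar R k).

(** The real part of the inner product turns [H] into a real inner product space.
    A self-adjoint operator stays self-adjoint for it and keeps its quadratic
    form, so most arguments below need no distinction between the scalar fields. *)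
Definition rdot u v : R := sre (inner H u v).
Definition rnorm u : R := sre `|u|.

Lemma normE u : `|u| = sreal (rnorm u).
Proof. exact: ge0_sreal. Qed.

Lemma rnorm_ge0 u : 0 <= rnorm u.
Proof. by rewrite -(@sreal_le R k) sreal0 -normE. Qed.

Lemma rnorm0 : rnorm 0 = 0.
Proof. by rewrite /rnorm normr0 sre0. Qed.

Lemma rnorm0_eq0 u : rnorm u = 0 -> u = 0.
Proof. by move=> u0; apply/eqP; rewrite -normr_eq0 normE u0 sreal0. Qed.

Lemma rnorm_gt0 u : u != 0 -> 0 < rnorm u.
Proof.
move=> u0; rewrite lt_neqAle rnorm_ge0 andbT eq_sym.
by apply: contra u0 => /eqP/rnorm0_eq0 ->.
Qed.

Lemma rnormD u v : rnorm (u + v) <= rnorm u + rnorm v.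
Proof. by rewrite -(@sreal_le R k) srealD -!normE ler_normD. Qed.

Lemma rnormN u : rnorm (- u) = rnorm u.
Proof. by rewrite /rnorm normrN. Qed.

Lemma rnormB u v : rnorm (u - v) = rnorm (v - u).
Proof. by rewrite -rnormN opprB. Qed.

Lemma rnormZ z u : rnorm (z *: u) = sre `|z| * rnorm u.
Proof. by rewrite /rnorm normrZ (ge0_sreal (normr_ge0 z)) sre_realM sre_real. Qed.

Lemma rnormZr a u : rnorm (sreal a *: u) = `|a| * rnorm u.
Proof. by rewrite rnormZ sreal_norm sre_real. Qed.

Lemma innerC u v : inner H u v = sconj (inner H v u).
Proof.
have /= -> := @hermitian_subproof _ _ _ _ (inner H) u v.
by rewrite expr0 mul1r.
Qed.

Lemma rdotC u v : rdot u v = rdot v u.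
Proof. by rewrite /rdot innerC sre_conj. Qed.

Lemma rdotDl u v w : rdot (u + v) w = rdot u w + rdot v w.
Proof. by rewrite /rdot linearDl sreD. Qed.

Lemma rdotNl u v : rdot (- u) v = - rdot u v.
Proof. by rewrite /rdot linearNl sreN. Qed.

Lemma rdotBl u v w : rdot (u - v) w = rdot u w - rdot v w.
Proof. by rewrite rdotDl rdotNl. Qed.

Lemma rdotZl a u v : rdot (sreal a *: u) v = a * rdot u v.
Proof. by rewrite /rdot linearZl_LR sre_realM. Qed.

Lemma rdot0l u : rdot 0 u = 0.
Proof. by rewrite /rdot linear0l sre0. Qed.

Lemma rdotDr u v w : rdot w (u + v) = rdot w u + rdot w v.
Proof. by rewrite ![rdot w _]rdotC rdotDl. Qed.
Lemma rdotNr u v : rdot u (- v) = - rdot u v.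
Proof. by rewrite ![rdot u _]rdotC rdotNl. Qed.
Lemma rdotBr u v w : rdot w (u - v) = rdot w u - rdot w v.
Proof. by rewrite ![rdot w _]rdotC rdotBl. Qed.
Lemma rdotZr a u v : rdot u (sreal a *: v) = a * rdot u v.
Proof. by rewrite ![rdot u _]rdotC rdotZl. Qed.

Definition rdotE := (rdotDl, rdotBl, rdotNl, rdotZl, rdotDr, rdotBr, rdotNr, rdotZr).

Lemma rdotuu u : rdot u u = rnorm u ^+ 2.
Proof.
by rewrite /rdot -inner_norm normE expr2 -srealM sre_real expr2.
Qed.

End Geometry.

(** * Bounded operators, positive forms, completeness *)

Section Operators.
Context {R : realType} {k : scalar_kind} {H : hilbertSpace R k}.
Implicit Types (u v w : H) (a b : R) (z : scalar R k) (T A B : H -> H).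

Lemma linear_op0 T : linear T -> T 0 = 0.
Proof.
move=> lT; have := lT 1 0 0; rewrite scale1r addr0 scale1r => h.
by apply: (addrI (T 0)); rewrite addr0 -h.
Qed.
Lemma linear_opD T u v : linear T -> T (u + v) = T u + T v.
Proof. by move=> lT; have := lT 1 u v; rewrite !scale1r. Qed.
Lemma linear_opZ T z u : linear T -> T (z *: u) = z *: T u.
Proof. by move=> lT; have := lT z u 0; rewrite !addr0 linear_op0// addr0. Qed.
Lemma linear_opN T u : linear T -> T (- u) = - T u.
Proof. by move=> lT; rewrite -scaleN1r linear_opZ// scaleN1r. Qed.
Lemma linear_opB T u v : linear T -> T (u - v) = T u - T v.
Proof. by move=> lT; rewrite linear_opD// linear_opN. Qed.

(** Positivity of the form is asked only on the line through [u] directed by [v],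
    because the spectral theorem applies this on an orthogonal complement. *)
Lemma psd_cauchy_schwarz T u v : linear T ->
  (forall x y, rdot (T x) y = rdot x (T y)) ->
  (forall t, 0 <= rdot (T (u + sreal t *: v)) (u + sreal t *: v)) ->
  0 <= rdot (T v) v ->
  rdot (T u) v ^+ 2 <= rdot (T u) u * rdot (T v) v.
Proof.
move=> lT sT pT v0; apply: discr_le => // t; have := pT t.
rewrite linear_opD// linear_opZ// !rdotE [rdot (T v) u]sT [rdot v (T u)]rdotC.
by move=> h; apply: le_trans h _; rewrite le_eqVlt; apply/orP; left; apply/eqP; ring.
Qed.

Lemma cauchy_schwarz u v : `|rdot u v| <= rnorm u * rnorm v.
Proof.
have h : rdot u v ^+ 2 <= rdot u u * rdot v v.
  apply: (@psd_cauchy_schwarz idfun) => // [t|]; rewrite /= rdotuu sqr_ge0//.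
rewrite -(@ler_pXn2r _ 2) ?nnegrE ?mulr_ge0 ?rnorm_ge0//.
by rewrite exprMn -!rdotuu -normrX ger0_norm// sqr_ge0.
Qed.

Lemma rdot_le u v : rdot u v <= rnorm u * rnorm v.
Proof. exact: le_trans (ler_norm _) (cauchy_schwarz u v). Qed.

Definition opbound T (K : R) := forall u, rnorm (T u) <= K * rnorm u.

(** Cauchy-Schwarz for the form of [T] at [u] and [T u]: where the form of a
    positive operator is small, the operator itself is small. *)
Lemma psd_rnorm_sq T K u : linear T -> opbound T K -> 0 <= K ->
  (forall x y, rdot (T x) y = rdot x (T y)) ->
  (forall t, 0 <= rdot (T (u + sreal t *: T u)) (u + sreal t *: T u)) ->
  0 <= rdot (T (T u)) (T u) ->
  rnorm (T u) ^+ 2 <= K * rdot (T u) u.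
Proof.
move=> lT bT K0 sT pT p0.
have u0 : 0 <= rdot (T u) u by have := pT 0; rewrite sreal0 scale0r addr0.
have := psd_cauchy_schwarz lT sT pT p0; rewrite rdotuu => h.
have h2 : rdot (T (T u)) (T u) <= K * rnorm (T u) ^+ 2.
  apply: le_trans (rdot_le _ _) _; rewrite expr2 mulrA.
  by apply: ler_wpM2r (bT _); exact: rnorm_ge0.
have := le_trans h (ler_wpM2l u0 h2).
have [->|n0] := eqVneq (rnorm (T u)) 0; first by rewrite expr0n/= mulr_ge0.
rewrite [X in X <= _]expr2 [X in _ <= X]mulrA ler_pM2r; last first.
  by rewrite lt_neqAle sqr_ge0 eq_sym sqrf_eq0 n0.
by rewrite mulrC.
Qed.

Lemma cvg_rnorm {I} (F : set_system I) {FF : Filter F} (f : I -> H) (l : H) :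
  f x @[x --> F] --> l <-> rnorm (f x - l) @[x --> F] --> (0 : R).
Proof.
split.
  move=> /cvgrPdist_lt h; apply/cvgrPdist_lt => e e0.
  have := h (sreal e); rewrite -{1}(@sreal0 R k) sreal_lt => /(_ e0).
  apply: filterS => x; rewrite normE sreal_lt sub0r normrN ger0_norm ?rnorm_ge0//.
  by rewrite rnormB.
move=> /cvgrPdist_lt h; apply/cvgrPdist_lt => e e0.
have ee : e = sreal (sre e) by apply: ge0_sreal; exact: ltW.
move: e0; rewrite ee -{1}(@sreal0 R k) sreal_lt => e0.
have := h _ e0; apply: filterS => x.
by rewrite normE sreal_lt sub0r normrN ger0_norm ?rnorm_ge0// rnormB.
Qed.

Lemma opbound_continuous T K : linear T -> opbound T K -> continuous T.
Proof.
move=> lT bT x; apply/cvg_rnorm.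
have : rnorm (y - x) @[y --> x] --> (0 : R) by apply/cvg_rnorm; exact: cvg_id.
move=> h; apply: (@squeeze_cvgr _ _ _ _ (cst 0) (fun y => K * rnorm (y - x))).
- by near=> y; rewrite rnorm_ge0 -linear_opB//= bT.
- exact: cvg_cst.
- by rewrite -(mulr0 K); apply: cvgM => //; exact: cvg_cst.
Unshelve. all: by end_near. Qed.

(** Continuity at [0] gives a ball of radius [e] mapped into the unit ball; the
    factor [2] makes the rescaled vector lie strictly inside the ball. *)
Lemma continuous_opbound T : linear T -> continuous T ->
  exists2 K, 0 <= K & opbound T K.
Proof.
move=> lT cT; have /cvgrPdist_lt/(_ 1 ltr01) := cT 0.
rewrite linear_op0// => /nbhs_ballP[e /= e0 he].
have ee : e = sreal (sre e) by apply: ge0_sreal; exact: ltW.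
move: e0 he; rewrite ee -{1}(@sreal0 R k) sreal_lt => e0 he.
exists (2 / sre e); first by rewrite divr_ge0// ltW.
move=> u; have [->|u0] := eqVneq u 0.
  by rewrite linear_op0// rnorm0 mulr0.
have nu0 := rnorm_gt0 u0.
have := he (sreal (sre e / 2 / rnorm u) *: u); rewrite -ball_normE/= sub0r normrN.
rewrite normE sreal_lt rnormZr ger0_norm ?divr_ge0 ?rnorm_ge0 ?(ltW e0)//.
rewrite divfK ?gt_eqF// ltr_pdivrMr// mulr_natr mulr2n ltrDl => /(_ e0).
rewrite sub0r normrN normE linear_opZ// rnormZr -{1}(@sreal1 R k) sreal_lt.
rewrite ger0_norm ?divr_ge0 ?rnorm_ge0 ?(ltW e0)// => h; apply: ltW.
rewrite -ltr_pdivrMr//.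
rewrite -[X in X < _](_ : (2 / sre e) * (sre e / 2 / rnorm u * rnorm (T u)) = _); last first.
  by field; rewrite !gt_eqF.
by rewrite -[ltRHS]mulr1 ltr_pM2l// divr_gt0.
Qed.

(** The fixed point iteration, the expansion in an orthonormal basis and the
    exponential series all converge for this reason. *)
Lemma summable_cvg (u : nat -> H) (b : nat -> R) :
  cvgn (series b) -> (forall n, rnorm (u n.+1 - u n) <= b n) -> cvgn u.
Proof.
move=> /cauchy_cvgP/cauchy_seriesP cb ub.
have tele n m : (n <= m)%N -> rnorm (u m - u n) <= \sum_(n <= i < m) b i.
  elim: m => [|m IHm]; first by rewrite leqn0 => /eqP ->; rewrite subrr rnorm0 big_geq.
  rewrite leq_eqVlt => /predU1P[->|]; first by rewrite subrr rnorm0 big_geq.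
  rewrite ltnS => nm; rewrite big_nat_recr//= -(subrKA (u m)) addrC.
  by apply: le_trans (rnormD _ _) _; rewrite lerD ?IHm.
apply/cauchy_cvgP/cauchyP => e e0.
have ee : e = sreal (sre e) by apply: ge0_sreal; exact: ltW.
move: e0; rewrite ee -{1}(@sreal0 R k) sreal_lt => e0.
have [[N1 N2] /= [[M1 _ HM1] [M2 _ HM2]] h] := cb _ e0.
pose N := maxn M1 M2.
exists (u N); exists N => // m /= Nm.
rewrite -ball_normE/= normE sreal_lt rnormB; apply: le_lt_trans (tele _ _ Nm) _.
apply: le_lt_trans (ler_norm _) _.
apply: (h (N, m)); split => /=; [apply: HM1|apply: HM2] => //=.
  by rewrite leq_maxl.
by apply: leq_trans Nm; rewrite leq_maxr.
Qed.

End Operators.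

(** * Numerical radius and coercive operators *)

Section Spectrum.
Context {R : realType} {k : scalar_kind} {H : hilbertSpace R k}.
Implicit Types (u v w : H) (a b : R) (z : scalar R k) (T A B : H -> H).

Definition selfadjoint A := forall u v, rdot (A u) v = rdot u (A v).

Lemma rdot_rnormZ a A u : linear A ->
  rdot (A (sreal a *: u)) (sreal a *: u) = a ^+ 2 * rdot (A u) u.
Proof. by move=> lA; rewrite linear_opZ// !rdotE; ring. Qed.

Lemma unit_vector u : u != 0 -> rnorm (sreal (rnorm u)^-1 *: u) = 1.
Proof.
by move=> /rnorm_gt0 u0; rewrite rnormZr ger0_norm ?invr_ge0 ?ltW// mulVf ?gt_eqF.
Qed.

Lemma form_le_homog A c : linear A ->
  (forall u, rnorm u = 1 -> rdot (A u) u <= c) ->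
  forall u, rdot (A u) u <= c * rnorm u ^+ 2.
Proof.
move=> lA h u; have [->|u0] := eqVneq u 0.
  by rewrite linear_op0// rdot0l rnorm0 expr0n mulr0.
have := h _ (unit_vector u0); rewrite rdot_rnormZ// exprVn mulrC.
by rewrite ler_pdivrMr// exprn_gt0// rnorm_gt0.
Qed.

(** Polarize with a second vector [v] that has the direction of [A u] and the
    length of [u], then use the parallelogram law. *)
Lemma numerical_radius_bound A M : linear A -> selfadjoint A ->
  (forall u, `|rdot (A u) u| <= M * rnorm u ^+ 2) -> opbound A M.
Proof.
move=> lA sA h u; have [->|u0] := eqVneq u 0.
  by rewrite linear_op0// rnorm0 mulr0.
have nu := rnorm_gt0 u0.
have M0 : 0 <= M.
  by have := le_trans (normr_ge0 _) (h u); rewrite pmulr_lge0// exprn_gt0.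
have [->|Au0] := eqVneq (A u) 0; first by rewrite rnorm0 mulr_ge0// ltW.
have nA := rnorm_gt0 Au0.
have [v [nv Auv]] : exists v, rnorm v = rnorm u /\ rdot (A u) v = rnorm u * rnorm (A u).
  exists (sreal (rnorm u / rnorm (A u)) *: A u); split.
    by rewrite rnormZr ger0_norm ?divr_ge0 ?ltW// divfK ?gt_eqF.
  by rewrite rdotZr rdotuu; field; rewrite gt_eqF.
have Avu : rdot (A v) u = rnorm u * rnorm (A u) by rewrite sA rdotC.
have h1 := le_trans (ler_norm _) (h (u + v)).
have h2 := le_trans (ler_norm _) (h (u - v)).
have h3 := h (u - v); move: h3; rewrite ler_norml => /andP[h3 _].
move: h1 h3; rewrite linear_opD// linear_opB// -!rdotuu !rdotE.
rewrite !rdotuu nv Auv Avu [rdot v u]rdotC => h1 h3.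
by rewrite -(ler_pM2l nu); lra.
Qed.

(** A coercive self-adjoint operator is onto: for a small step [s], the map
    [x |-> x + s (f - T x)] contracts, and its fixed point solves [T x = f]. *)
Lemma coercive_surjective T K c : linear T -> selfadjoint T -> opbound T K ->
  0 < c -> (forall u, c * rnorm u ^+ 2 <= rdot (T u) u) ->
  forall f, exists x, T x = f.
Proof.
move=> lT sT bT c0 cT f.
pose K' := Num.max K c; have K'0 : 0 < K' by rewrite lt_max c0 orbT.
pose s := K'^-1; have s0 : 0 < s by rewrite invr_gt0.
pose G x := x - sreal s *: T x.
have lG : linear G.
  move=> z u v; rewrite /G lT !scalerDr scalerN !scalerA [sreal s * z]mulrC opprD.
  by rewrite addrACA.
have sG : selfadjoint G.
  by move=> u v; rewrite /G !rdotE sT.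
pose q := 1 - s * c.
have q0 : 0 <= q.
  by rewrite subr_ge0 /s mulrC ler_pdivrMr// mul1r le_max lexx orbT.
have q1 : q < 1 by rewrite ltrBlDr ltrDl mulr_gt0.
have bG : opbound G q.
  apply: numerical_radius_bound => // u.
  have h1 : rdot (T u) u <= K' * rnorm u ^+ 2.
    apply: le_trans (rdot_le _ _) _; rewrite expr2 mulrA ler_wpM2r ?rnorm_ge0//.
    by apply: le_trans (bT u) _; rewrite ler_wpM2r ?rnorm_ge0// le_max lexx.
  have h2 : 0 <= rdot (G u) u.
    rewrite /G !rdotE rdotuu subr_ge0 /s mulrC ler_pdivrMr// mulrC//.
  rewrite ger0_norm// /G !rdotE rdotuu /q mulrBl mul1r lerD2l lerN2 -mulrA.
  by rewrite ler_pM2l.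
pose x := fun n => iter n (fun y => y + sreal s *: (f - T y)) (0 : H).
have dx n : x n.+2 - x n.+1 = G (x n.+1 - x n).
  rewrite /G linear_opB// [x n.+2]/= -/(x n.+1) [in LHS]addrC addKr.
  rewrite [X in _ = X - _ - _](_ : _ = x n + sreal s *: (f - T (x n)))//.
  rewrite [X in _ = X - _](_ : _ = sreal s *: (f - T (x n))); last first.
    by rewrite addrC addKr.
  by rewrite -scalerBr; congr (_ *: _); rewrite opprB addrA subrK.
have bx n : rnorm (x n.+1 - x n) <= geometric (rnorm (x 1%N)) q n.
  elim: n => [|n IHn]; first by rewrite /= subr0 expr0 mulr1.
  rewrite dx; apply: le_trans (bG _) _.
  by rewrite /= exprS mulrCA ler_wpM2l.
have : cvgn x.
  apply: summable_cvg bx; apply: is_cvg_geometric_series.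
  by rewrite ger0_norm.
move=> /cvg_ex[l xl]; exists l.
have cT' := opbound_continuous lT bT.
have Txl : T (x n) @[n --> \oo] --> T l by apply: continuous_cvg => //; exact: cT'.
have xSl : x n.+1 @[n --> \oo] --> l by rewrite (@cvg_shiftS _ x).
have : (x n.+1 - x n) @[n --> \oo] --> l - l by apply: cvgB.
have -> : (fun n => x n.+1 - x n) = (fun n => sreal s *: (f - T (x n))).
  by apply/funext => n; rewrite /= addrC addKr.
rewrite subrr => h1.
have h2 : sreal s *: (f - T (x n)) @[n --> \oo] --> sreal s *: (f - T l).
  by apply: cvgZr; apply: cvgB => //; exact: cvg_cst.
have /eqP : sreal s *: (f - T l) = 0.
  by apply: (cvg_unique (@norm_hausdorff _ _) _ h1); exact: h2.
rewrite scaler_eq0 => /orP[/eqP/(congr1 sre)|/eqP/subr0_eq//].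
by rewrite sre_real sre0 => s00; rewrite s00 ltxx in s0.
Qed.

End Spectrum.

(** * Extreme spectral values as suprema of the quadratic form *)

Section LambdaMax.
Context {R : realType} {k : scalar_kind} {H : hilbertSpace R k}.
Implicit Types (u v w : H) (a b : R) (z : scalar R k) (T A B : H -> H).

Lemma linear_shift A t : linear A -> linear (fun u => sreal t *: u - A u).
Proof.
move=> lA z u v; rewrite lA !scalerDr scalerN !scalerA [sreal t * z]mulrC opprD.
by rewrite addrACA.
Qed.

Lemma selfadjoint_shift A t : selfadjoint A ->
  selfadjoint (fun u => sreal t *: u - A u).
Proof. by move=> sA u v; rewrite !rdotE sA. Qed.

Lemma opbound_shift A K t : opbound A K ->
  opbound (fun u => sreal t *: u - A u) (`|t| + K).
Proof.
move=> bA u; apply: le_trans (rnormD _ _) _.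
by rewrite rnormN rnormZr mulrDl lerD2l.
Qed.

Lemma rdot_shift A t u :
  rdot (sreal t *: u - A u) u = t * rnorm u ^+ 2 - rdot (A u) u.
Proof. by rewrite !rdotE rdotuu. Qed.

(** When [t] exceeds the form by a positive constant, [t - A] is coercive, hence
    onto, and coercivity bounds its inverse. *)
Lemma spectrum_le A K c t : linear A -> selfadjoint A -> opbound A K ->
  (forall u, rdot (A u) u <= c * rnorm u ^+ 2) ->
  spectrum A (sreal t) -> t <= c.
Proof.
move=> lA sA bA Ac; apply: contra_notT; rewrite -ltNge => ct.
pose T := fun u => sreal t *: u - A u.
have lT : linear T by exact: linear_shift.
have sT : selfadjoint T by exact: selfadjoint_shift.
have bT := opbound_shift t bA.
have tc0 : 0 < t - c by rewrite subr_gt0.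
have cT u : (t - c) * rnorm u ^+ 2 <= rdot (T u) u.
  by rewrite rdot_shift mulrBl lerD2l lerN2.
have /choice[B TB] := coercive_surjective lT sT bT tc0 cT.
have cT' u : (t - c) * rnorm u <= rnorm (T u).
  have [->|u0] := eqVneq u 0; first by rewrite rnorm0 mulr0 rnorm_ge0.
  rewrite -(ler_pM2r (rnorm_gt0 u0)) -mulrA -expr2.
  exact: le_trans (cT u) (rdot_le _ _).
have injT u v : T u = T v -> u = v.
  move=> Tuv; apply/subr0_eq/rnorm0_eq0/le_anti; rewrite rnorm_ge0 andbT.
  by have := cT' (u - v); rewrite linear_opB// Tuv subrr rnorm0 pmulr_rle0.
exists (fun u => - B u); split.
- have lB : linear (fun u => - B u).
    move=> z u v; rewrite scalerN -opprD; congr (- _); apply: injT.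
    by rewrite lT !TB.
  split => //; apply: (@opbound_continuous _ _ _ _ (t - c)^-1) => // u.
  rewrite rnormN mulrC ler_pdivlMr// mulrC; apply: le_trans (cT' _) _.
  by rewrite TB.
- by move=> u; apply: injT; rewrite linear_opN// TB /T opprB.
- move=> u; rewrite (linear_opN (B u) lA) scalerN opprK addrC.
  exact: TB.
Qed.

(** The operator [t - A] is positive, hence small at the unit vectors where its
    form is small, the near maximizers of the form of [A]: it has no bounded
    inverse. *)
Lemma spectrum_sup A K t : linear A -> selfadjoint A -> opbound A K -> 0 <= K ->
  (forall u, rdot (A u) u <= t * rnorm u ^+ 2) ->
  (forall e, 0 < e -> exists2 u, rnorm u = 1 & t - e < rdot (A u) u) ->
  spectrum A (sreal t).
Proof.
move=> lA sA bA K0 At tA [B [[lB cB] BA _]].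
have [L L0 bB] := continuous_opbound lB cB.
pose T := fun u => sreal t *: u - A u.
have lT : linear T by exact: linear_shift.
have sT : selfadjoint T by exact: selfadjoint_shift.
have bT := opbound_shift t bA.
have pT u : 0 <= rdot (T u) u by rewrite rdot_shift subr_ge0.
have K'0 : 0 <= `|t| + K by rewrite addr_ge0.
pose e := (L ^+ 2 * (`|t| + K) + 1)^-1.
have D0 : 0 < L ^+ 2 * (`|t| + K) + 1.
  by rewrite ltr_wpDl// mulr_ge0// sqr_ge0.
have e0 : 0 < e by rewrite invr_gt0.
have [u u1 tu] := tA e e0.
have h1 : rnorm (T u) ^+ 2 <= (`|t| + K) * rdot (T u) u by exact: psd_rnorm_sq.
have h2 : rdot (T u) u <= e by rewrite rdot_shift u1 expr1n mulr1; lra.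
have h3 : 1 <= L * rnorm (T u).
  rewrite -[leLHS]u1 -{1}[u]BA -[A u - _]opprB linear_opN// rnormN; exact: bB.
have h4 : 1 <= L ^+ 2 * rnorm (T u) ^+ 2.
  by rewrite -exprMn -[leLHS](expr1n _ 2) ler_pXn2r ?nnegrE// mulr_ge0// rnorm_ge0.
have h5 : L ^+ 2 * rnorm (T u) ^+ 2 <= L ^+ 2 * ((`|t| + K) * e).
  rewrite ler_wpM2l ?sqr_ge0//; apply: le_trans h1 _.
  by rewrite ler_wpM2l.
have := le_trans h4 h5; rewrite mulrA ler_pdivlMr// mul1r.
by rewrite gerDl ler10.
Qed.

(** The supremum of the form over unit vectors bounds the spectrum and belongs to
    it. Strict inequalities make the equivalence true whether or not this
    supremum is attained. *)
Lemma lambda_max_gt A K c : linear A -> selfadjoint A -> opbound A K -> 0 <= K ->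
  (exists u : H, u != 0) ->
  c < lambda_max A <-> exists2 u, rnorm u = 1 & c < rdot (A u) u.
Proof.
move=> lA sA bA K0 [u0 u00].
pose S := [set rdot (A u) u | u in [set u | rnorm u = 1]].
have hS : has_sup S.
  split; first by eexists; exists (sreal (rnorm u0)^-1 *: u0) => //; exact: unit_vector.
  exists K => _ [u /= u1 <-]; apply: le_trans (rdot_le _ _) _.
  by rewrite u1 mulr1; apply: le_trans (bA u) _; rewrite u1 mulr1.
have leS : forall u, rdot (A u) u <= sup S * rnorm u ^+ 2.
  apply: form_le_homog => // u u1; apply: ub_le_sup => //; first by case: hS.
  by exists u.
have -> : lambda_max A = sup S.
  have ub : ubound [set t | spectrum A (sreal t)] (sup S).
    by move=> t /= At; apply: (spectrum_le lA sA bA).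
  have mem : spectrum A (sreal (sup S)).
    apply: (spectrum_sup lA sA bA K0) => // e e0.
    by have [_ [u /= u1 <-] ?] := sup_adherent e0 hS; exists u.
  apply/le_anti/andP; split; first by apply: ge_sup => //; exists (sup S).
  by apply: ub_le_sup => //; exists (sup S).
split=> [cS|[u u1 cu]].
  have e0 : 0 < sup S - c by rewrite subr_gt0.
  have [_ [u /= u1 <-] h] := sup_adherent e0 hS; exists u => //.
  by rewrite subKr in h.
by apply: lt_le_trans cu _; apply: ub_le_sup; [case: hS|exists u].
Qed.

Lemma lambda_max_zero_space : (forall u : H, u = 0) ->
  forall A, lambda_max A = 0.
Proof.
move=> H0 A; rewrite /lambda_max (_ : [set t | _] = set0) ?sup0//.
rewrite -subset0 => t /=; apply; exists (fun=> 0); split.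
- split; first by move=> z u v; rewrite scaler0 addr0.
  by move=> x; exact: cvg_cst.
- by move=> u; rewrite [u]H0.
- by move=> u; rewrite [LHS]H0 [u]H0.
Qed.

Lemma opnorm_zero_space : (forall u : H, u = 0) ->
  forall A, opnorm A = 0.
Proof.
move=> H0 A; rewrite /opnorm (_ : [set _ | _ in _] = [set 0]) ?sup1//.
apply/seteqP; split => [_ [u _ <-]|_ ->]; first by rewrite [A u]H0 normr0 sre0.
by exists 0; rewrite /= ?normr0// [A 0]H0 normr0 sre0.
Qed.

Lemma compact_selfadjoint_linear A : compact_selfadjoint A -> linear A.
Proof. by case. Qed.

Lemma compact_selfadjoint_rdot A : compact_selfadjoint A -> selfadjoint A.
Proof. by case=> _ _ sA u v; rewrite /rdot sA. Qed.

Lemma continuous_rnorm : continuous (@rnorm R k H).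
Proof.
move=> x; apply/cvgrPdist_lt => e e0.
have /cvg_rnorm/cvgrPdist_lt/(_ e e0) : y @[y --> x] --> x by exact: cvg_id.
apply: filterS => y; rewrite sub0r normrN ger0_norm ?rnorm_ge0//.
apply: le_lt_trans.
have h1 : rnorm y <= rnorm (y - x) + rnorm x by rewrite -{1}(subrK x y) rnormD.
have h2 : rnorm x <= rnorm (x - y) + rnorm y by rewrite -{1}(subrK y x) rnormD.
by move: h2; rewrite rnormB ler_norml => h2; lra.
Qed.

(** The image of the unit ball lies in a compact set, on which [rnorm] is bounded. *)
Lemma compact_opbound A : compact_selfadjoint A -> exists2 K, 0 <= K & opbound A K.
Proof.
case=> lA [U AU [cU _]] _.
have : compact (@rnorm R k H @` U).
  by apply: continuous_compact => //; apply: continuous_subspaceT; exact: continuous_rnorm.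
move=> /compact_bounded [M [_ /(_ (`|M| + 1))]].
rewrite ltr_pwDr ?ler_norm// => /(_ isT) bU.
exists (`|M| + 1); first by rewrite addr_ge0.
move=> u; have [->|u0] := eqVneq u 0.
  by rewrite linear_op0// rnorm0 mulr0.
have : U (A (sreal (rnorm u)^-1 *: u)).
  apply: AU; exists (sreal (rnorm u)^-1 *: u) => //=.
  by rewrite normE unit_vector// sreal1.
move=> Ux; have := bU (rnorm (A (sreal (rnorm u)^-1 *: u))) (ex_intro2 _ _ _ Ux erefl).
rewrite /= ger0_norm ?rnorm_ge0// (linear_opZ _ _ lA) rnormZr ger0_norm ?invr_ge0 ?rnorm_ge0//.
by rewrite ler_pdivrMl ?rnorm_gt0// mulrC.
Qed.

Lemma opnorm_has_sup A K : opbound A K -> 0 <= K -> linear A ->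
  has_sup [set sre `|A u| | u in [set u | `|u| <= 1]].
Proof.
move=> bA K0 lA; split.
  by exists (rnorm (A 0)), 0 => //=; rewrite normr0.
exists K => _ [u /= + <-]; rewrite normE -(@sreal1 R k) sreal_le => u1.
apply: le_trans (bA u) _; rewrite -[leRHS]mulr1; apply: ler_wpM2l => //.
Qed.

Lemma opbound_opnorm A K : opbound A K -> 0 <= K -> linear A -> opbound A (opnorm A).
Proof.
move=> bA K0 lA u; have [->|u0] := eqVneq u 0.
  by rewrite linear_op0// rnorm0 mulr0.
rewrite -ler_pdivrMr ?rnorm_gt0//; apply: ub_le_sup.
  by case: (opnorm_has_sup bA K0 lA).
exists (sreal (rnorm u)^-1 *: u); first by rewrite /= normE unit_vector// sreal1.
rewrite linear_opZ// -/(rnorm _) rnormZr mulrC ger0_norm// invr_ge0 rnorm_ge0//.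
Qed.

Lemma opnorm_le A K : opbound A K -> 0 <= K -> linear A -> opnorm A <= K.
Proof.
move=> bA K0 lA; apply: ge_sup; first by case: (opnorm_has_sup bA K0 lA).
move=> _ [u /= + <-]; rewrite normE -(@sreal1 R k) sreal_le => u1.
apply: le_trans (bA u) _; rewrite -[leRHS]mulr1; apply: ler_wpM2l => //.
Qed.

(** The norm is at most the numerical radius by [numerical_radius_bound], and at
    least the numerical radius by Cauchy-Schwarz. *)
Lemma opnorm_gt A K c : linear A -> selfadjoint A -> opbound A K -> 0 <= K ->
  (exists u : H, u != 0) ->
  c < opnorm A <-> exists2 u, rnorm u = 1 & c < `|rdot (A u) u|.
Proof.
move=> lA sA bA K0 [u0 u00].
split; last first.
  move=> [u u1 cu]; apply: lt_le_trans cu _; apply: le_trans (cauchy_schwarz _ _) _.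
  rewrite u1 mulr1; apply: le_trans (opbound_opnorm bA K0 lA u) _.
  by rewrite u1 mulr1.
apply: contraPP => h; apply/negP; rewrite -leNgt.
have h' u : rnorm u = 1 -> `|rdot (A u) u| <= c.
  by move=> u1; rewrite leNgt; apply/negP => cu; apply: h; exists u.
have c0 : 0 <= c by apply: le_trans (h' _ (unit_vector u00)).
apply: opnorm_le => //; apply: numerical_radius_bound => // u.
have [->|un] := eqVneq u 0.
  by rewrite linear_op0// rdot0l normr0 mulr_ge0// sqr_ge0.
have := h' _ (unit_vector un); rewrite rdot_rnormZ// exprVn mulrC.
rewrite normrM [X in _ * X]ger0_norm ?invr_ge0 ?sqr_ge0//.
by rewrite ler_pdivrMr// exprn_gt0// rnorm_gt0.
Qed.

End LambdaMax.

(** * Expansions in an orthonormal basis *)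

Section Basis.
Context {R : realType} {k : scalar_kind} {H : hilbertSpace R k}.
Implicit Types (u v w : H) (a b : R) (z : scalar R k) (T A B : H -> H).
Implicit Types (E : set H) (s t : seq H).

Definition orthonormal_set E :=
  (forall e, E e -> inner H e e = 1) /\
  (forall e e', E e -> E e' -> e <> e' -> inner H e e' = 0).

Definition finite_part E s := uniq s /\ {in s, forall e, E e}.

Definition oproj s u : H := \sum_(e <- s) inner H u e *: e.

Definition bessel_sum s u : R := \sum_(e <- s) sqmod (inner H u e).

Lemma innerZl z u v : inner H (z *: u) v = z * inner H u v.
Proof. by rewrite linearZl_LR. Qed.

Lemma innerZr z u v : inner H u (z *: v) = sconj z * inner H u v.
Proof. by rewrite linearZr_LR. Qed.

Lemma innerDl u v w : inner H (u + v) w = inner H u w + inner H v w.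
Proof. exact: linearDl. Qed.

Lemma innerBl u v w : inner H (u - v) w = inner H u w - inner H v w.
Proof. exact: linearBl. Qed.

Lemma inner_suml s (f : H -> H) u :
  inner H (\sum_(e <- s) f e) u = \sum_(e <- s) inner H (f e) u.
Proof. exact: linear_sumlz. Qed.

Lemma inner_sumr s (f : H -> H) u :
  inner H u (\sum_(e <- s) f e) = \sum_(e <- s) inner H u (f e).
Proof. exact: linear_sumr. Qed.

Lemma inner_oproj E s u e : orthonormal_set E -> finite_part E s -> E e ->
  inner H (oproj s u) e = if e \in s then inner H u e else 0.
Proof.
move=> [E1 E0] [us sE] Ee; rewrite /oproj inner_suml.
rewrite [LHS](_ : _ = \sum_(e' <- s) if e' == e then inner H u e else 0); last first.
  rewrite big_seq [RHS]big_seq; apply: eq_bigr => e' es; rewrite innerZl.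
  have [->|/eqP ne] := eqVneq e' e; first by rewrite E1// mulr1.
  by rewrite (E0 e' e) ?mulr0//; exact: sE.
rewrite -big_mkcond/=; case: ifPn => es.
  by rewrite -big_filter filter_pred1_uniq// big_seq1.
by rewrite big_seq_cond big_pred0// => e'; apply/negP => /andP[+ /eqP ee']; rewrite ee' (negbTE es).
Qed.

Lemma inner_oproj_r s u v : inner H u (oproj s v) =
  \sum_(e <- s) sconj (inner H v e) * inner H u e.
Proof. by rewrite /oproj inner_sumr; apply: eq_bigr => e _; rewrite innerZr. Qed.

Lemma rnorm_oproj E s u : orthonormal_set E -> finite_part E s ->
  rnorm (oproj s u) ^+ 2 = bessel_sum s u.
Proof.
move=> oE sE; rewrite -rdotuu /rdot inner_oproj_r sre_sum /bessel_sum.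
rewrite big_seq [RHS]big_seq; apply: eq_bigr => e es.
have Ee : E e by apply: sE.2.
by rewrite (inner_oproj _ oE)// es mulrC mul_conj sre_real.
Qed.

Lemma pythagoras E s u : orthonormal_set E -> finite_part E s ->
  rnorm (u - oproj s u) ^+ 2 = rnorm u ^+ 2 - bessel_sum s u.
Proof.
move=> oE sE.
have h : rdot (u - oproj s u) (oproj s u) = 0.
  rewrite /rdot inner_oproj_r big_seq big1 ?sre0// => e es.
  by rewrite innerBl (inner_oproj _ oE)//; [rewrite es subrr mulr0|apply: sE.2].
rewrite -rdotuu rdotBr h subr0 rdotBl rdotuu; congr (_ - _).
have := h; rewrite rdotBl rdotuu => /subr0_eq; rewrite rdotC => ->.
by rewrite (rnorm_oproj _ oE).
Qed.

Lemma bessel E s u : orthonormal_set E -> finite_part E s ->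
  bessel_sum s u <= rnorm u ^+ 2.
Proof. by move=> oE sE; rewrite -subr_ge0 -(pythagoras _ oE sE) sqr_ge0. Qed.

Lemma norm_inner_le E e u : orthonormal_set E -> E e ->
  sre `|inner H u e| <= rnorm u.
Proof.
move=> oE Ee; have : finite_part E [:: e].
  by split => // e'; rewrite inE => /eqP ->.
move=> /(bessel u oE); rewrite /bessel_sum big_seq1 sqmod_norm.
by rewrite ler_pXn2r// ?nnegrE ?rnorm_ge0// -(@sreal_le R k) sreal0 -ge0_sreal.
Qed.

(** The projection on [span s] factors through the one on [span t], so this is
    Pythagoras for [oproj t u]. *)
Lemma oproj_sub E s t u : orthonormal_set E -> finite_part E s -> finite_part E t ->
  {subset s <= t} ->
  rnorm (oproj t u - oproj s u) ^+ 2 = bessel_sum t u - bessel_sum s u.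
Proof.
move=> oE sE tE st.
have e1 : {in s, forall e, inner H (oproj t u) e = inner H u e}.
  by move=> e es; rewrite (inner_oproj _ oE) ?st//; apply: sE.2.
have -> : oproj s u = oproj s (oproj t u).
  by rewrite /oproj big_seq [RHS]big_seq; apply: eq_bigr => e /e1 ->.
rewrite (pythagoras _ oE sE) (rnorm_oproj _ oE tE); congr (_ - _).
by rewrite /bessel_sum big_seq [RHS]big_seq; apply: eq_bigr => e /e1 ->.
Qed.

Lemma finite_part_cat E s t : finite_part E s -> finite_part E t ->
  finite_part E (undup (s ++ t)).
Proof.
move=> [_ sE] [_ tE]; split; first exact: undup_uniq.
by move=> e; rewrite mem_undup mem_cat => /orP[/sE|/tE].
Qed.

(** Finite parts nearly exhausting the supremum of the Bessel sums give a Cauchy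
    sequence of projections, whose limit differs from [u] by a vector orthogonal
    to the basis, hence by [0]. *)
Lemma oproj_cvg E u : orthonormal_basis E ->
  exists s : nat -> seq H, (forall n, finite_part E (s n)) /\
    oproj (s n) u @[n --> \oo] --> u.
Proof.
move=> [E1 E0 E2]; have oE : orthonormal_set E by [].
pose S := [set bessel_sum s u | s in finite_part E].
have hS : has_sup S.
  split; first by exists (bessel_sum [::] u), [::].
  by exists (rnorm u ^+ 2) => _ [s /= sE <-]; exact: (bessel u oE sE).
have leS s : finite_part E s -> bessel_sum s u <= sup S.
  by move=> sE; apply: ub_le_sup; [case: hS|exists s].
have d0 n : 0 < (2^-1 ^+ n) ^+ 2 :> R by rewrite !exprn_gt0// invr_gt0.
have /choice[s hs] : forall n, exists s, finite_part E s /\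
    sup S - (2^-1 ^+ n) ^+ 2 < bessel_sum s u.
  by move=> n; have [_ [s /= sE <-] h] := sup_adherent (d0 n) hS; exists s.
have sE n : finite_part E (s n) by case: (hs n).
(* Enlarging [s n] adds at most what is missing from the supremum. *)
have near n t : finite_part E t -> {subset s n <= t} ->
    rnorm (oproj t u - oproj (s n) u) <= 2^-1 ^+ n.
  move=> tE st.
  rewrite -(@ler_pXn2r _ 2) ?nnegrE ?rnorm_ge0 ?exprn_ge0 ?invr_ge0//.
  rewrite (oproj_sub _ oE)//; have [_ h] := hs n; have := leS _ tE; lra.
have cv : cvgn (fun n => oproj (s n) u).
  apply: (@summable_cvg _ _ _ _ (geometric 2 2^-1)).
    by apply: is_cvg_geometric_series; rewrite ger0_norm ?invr_ge0// invf_lt1 ?ltr1n ?ltr0n.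
  move=> n /=; set t := undup (s n ++ s n.+1).
  have tE : finite_part E t by exact: finite_part_cat.
  have t1 : {subset s n <= t} by move=> e es; rewrite mem_undup mem_cat es.
  have t2 : {subset s n.+1 <= t} by move=> e es; rewrite mem_undup mem_cat es orbT.
  rewrite -(subrKA (oproj t u)); apply: le_trans (rnormD _ _) _.
  have h1 := near _ _ tE t1; have h2 := near _ _ tE t2; rewrite rnormB in h2.
  have : (2^-1 : R) ^+ n.+1 <= 2^-1 ^+ n.
    by rewrite exprS ger_pMl ?exprn_gt0 ?invr_gt0// invf_le1//; lra.
  lra.
exists s; split => //; have /cvg_ex[v pv] := cv.
suff uv : u = v by rewrite [X in _ --> X]uv.
apply/subr0_eq/E2 => e Ee; apply/eqP; rewrite -normr_eq0.
rewrite (ge0_sreal (normr_ge0 _)).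
suff -> : sre `|inner H (u - v) e| = 0 by rewrite sreal0.
apply/le_anti; rewrite -[X in _ && X](@sreal_le R k) sreal0 -ge0_sreal// normr_ge0 andbT.
(* Either [e] is in [s n] and the first term vanishes, or adding [e] to [s n]
   shows that its coefficient is small. *)
have main n : sre `|inner H (u - v) e| <= 2^-1 ^+ n + rnorm (oproj (s n) u - v).
  rewrite -(subrKA (oproj (s n) u)) innerDl.
  apply: (@le_trans _ _ (sre `|inner H (u - oproj (s n) u) e| +
                         sre `|inner H (oproj (s n) u - v) e|)).
    by rewrite -(@sreal_le R k) srealD -!ge0_sreal// ler_normD.
  apply: lerD; last exact: norm_inner_le oE Ee.
  have e0 : 0 <= (2^-1 : R) ^+ n by rewrite exprn_ge0// invr_ge0.
  rewrite innerBl (inner_oproj _ oE)//; case: ifPn => es.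
    by rewrite subrr normr0 sre0.
  rewrite subr0 -(@ler_pXn2r _ 2) ?nnegrE//; last first.
    by rewrite -(@sreal_le R k) sreal0 -ge0_sreal.
  rewrite -sqmod_norm; have tE : finite_part E (e :: s n).
    split; first by rewrite /= es (sE n).1.
    by move=> e'; rewrite inE => /predU1P[->//|]; apply: (sE n).2.
  have [_] := hs n; have := leS _ tE; rewrite /bessel_sum big_cons; lra.
have : (2^-1 ^+ n + rnorm (oproj (s n) u - v)) @[n --> \oo] --> (0 + 0 : R).
  apply: cvgD; last exact/cvg_rnorm.
  by apply: cvg_expr; rewrite ger0_norm ?invr_ge0// invf_lt1 ?ltr1n ?ltr0n.
rewrite addr0 => h; by apply: (cvgr_to_ge h); near=> n; exact: main.
Unshelve. all: by end_near.
Qed.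

End Basis.

(** * Diagonal operators, quadratic forms and traces *)

Section FormsAndTraces.
Context {R : realType} {k : scalar_kind} {H : hilbertSpace R k}.
Implicit Types (u v w : H) (a b : R) (z : scalar R k) (T A B : H -> H).
Implicit Types (E : set H) (s t : seq H).

Lemma linear_op_sum A s (f : H -> H) : linear A ->
  A (\sum_(e <- s) f e) = \sum_(e <- s) A (f e).
Proof.
move=> lA; apply: (big_morph A); last exact: linear_op0.
by move=> x y; exact: linear_opD.
Qed.

Lemma rdot_suml s (f : H -> H) u :
  rdot (\sum_(e <- s) f e) u = \sum_(e <- s) rdot (f e) u.
Proof. by rewrite /rdot inner_suml sre_sum. Qed.

Lemma rdot_sumr s (f : H -> H) u :
  rdot u (\sum_(e <- s) f e) = \sum_(e <- s) rdot u (f e).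
Proof. by rewrite /rdot inner_sumr sre_sum. Qed.

Definition diagonal A E (l : H -> R) := forall e, E e -> A e = sreal (l e) *: e.

Lemma diagonal_oproj A E l s u : linear A -> diagonal A E l -> finite_part E s ->
  A (oproj s u) = \sum_(e <- s) (sreal (l e) * inner H u e) *: e.
Proof.
move=> lA dA [_ sE]; rewrite /oproj linear_op_sum// big_seq [RHS]big_seq.
by apply: eq_bigr => e /sE Ee; rewrite linear_opZ// dA// scalerA mulrC.
Qed.

Lemma rdot_cvg2 {I} (F : set_system I) {FF : Filter F} (f g : I -> H) l m :
  f x @[x --> F] --> l -> g x @[x --> F] --> m ->
  rdot (f x) (g x) @[x --> F] --> rdot l m.
Proof.
move=> fl gm.
have -> : (fun x => rdot (f x) (g x)) =
  (fun x => 4^-1 * (rnorm (f x + g x) ^+ 2 - rnorm (f x - g x) ^+ 2)).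
  by apply/funext => x; rewrite -!rdotuu !rdotE [rdot (g x) (f x)]rdotC; field.
have -> : rdot l m = 4^-1 * (rnorm (l + m) ^+ 2 - rnorm (l - m) ^+ 2).
  by rewrite -!rdotuu !rdotE [rdot m l]rdotC; field.
apply: cvgM; first exact: cvg_cst.
apply: cvgB; rewrite expr2; under eq_fun do rewrite expr2.
  by apply: cvgM; (apply: continuous_cvg; [exact: continuous_rnorm|exact: cvgD]).
by apply: cvgM; (apply: continuous_cvg; [exact: continuous_rnorm|exact: cvgB]).
Qed.

(** On a finite projection the form is a sum of terms [l e |<u, e>|^2], and the
    form is continuous. *)
Lemma diagonal_psd A E l : linear A -> continuous A -> orthonormal_basis E ->
  diagonal A E l -> (forall e, E e -> 0 <= l e) -> forall u, 0 <= rdot (A u) u.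
Proof.
move=> lA cA oE dA l0 u; have [s [sE su]] := oproj_cvg u oE.
have oE' : orthonormal_set E by case: oE.
have Asu : A (oproj (s n) u) @[n --> \oo] --> A u by apply: continuous_cvg; [exact: cA|].
apply: (cvgr_to_ge (rdot_cvg2 Asu su)); near=> n.
rewrite (diagonal_oproj _ lA dA)// rdot_suml big_seq; apply: sumr_ge0 => e es.
have Ee : E e by apply: (sE n).2.
rewrite -scalerA rdotZl rdotC mulr_ge0 ?l0// /rdot innerZr (inner_oproj _ oE')// es.
by rewrite mulrC mul_conj sre_real sqmod_ge0.
Unshelve. all: by end_near. Qed.

(** Finite projections of [u] and [v] reduce this to pairs of basis vectors, where
    distinct vectors contribute [0]. *)
Lemma diagonal_selfadjoint A E l : linear A -> continuous A -> orthonormal_basis E ->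
  diagonal A E l -> selfadjoint A.
Proof.
move=> lA cA oE dA u v.
have oE' : orthonormal_set E by case: oE.
have [s [sE su]] := oproj_cvg u oE; have [t [tE tv]] := oproj_cvg v oE.
have Asu : A (oproj (s n) u) @[n --> \oo] --> A u by apply: continuous_cvg; [exact: cA|].
have Atv : A (oproj (t n) v) @[n --> \oo] --> A v by apply: continuous_cvg; [exact: cA|].
have h1 : rdot (A (oproj (s n) u)) (oproj (t n) v) @[n --> \oo] --> rdot (A u) v.
  exact: rdot_cvg2.
have h2 : rdot (oproj (s n) u) (A (oproj (t n) v)) @[n --> \oo] --> rdot u (A v).
  exact: rdot_cvg2.
apply: (@cvg_unique _ (@Rhausdorff R) _ _ _ _ h1).
apply: cvg_trans h2; apply: near_eq_cvg; near=> n.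
rewrite (diagonal_oproj _ lA dA)// (diagonal_oproj _ lA dA)// /oproj.
rewrite !rdot_suml big_seq [RHS]big_seq; apply: eq_bigr => e /(sE n).2 Ee.
rewrite !rdot_sumr big_seq [RHS]big_seq; apply: eq_bigr => e' /(tE n).2 Ee'.
rewrite -!scalerA rdotZl rdotZr.
have [->|/eqP ee'] := eqVneq e e'; first by [].
by rewrite /rdot innerZl innerZr (oE'.2 e e')// !mulr0 sre0 !mulr0.
Unshelve. all: by end_near. Qed.

(** With [N] the squared norm of the projection [p] and [x] its component along
    [e], the form is nonnegative at [|x|^2 p - N x]; dividing by [|x|^2] and
    summing over [e] gives the bound. *)
Lemma form_oproj_le A E s u : linear A -> selfadjoint A ->
  (forall u, 0 <= rdot (A u) u) -> orthonormal_set E -> finite_part E s ->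
  rdot (A (oproj s u)) (oproj s u) <=
  rnorm (oproj s u) ^+ 2 * \sum_(e <- s) rdot (A e) e.
Proof.
move=> lA sA pA oE sE; rewrite (rnorm_oproj _ oE sE).
set p := oproj s u; set N := bessel_sum s u.
have N0 : 0 <= N by apply: sumr_ge0 => e _; exact: sqmod_ge0.
have main e : 2 * N * rdot (A p) (inner H u e *: e) <=
    sqmod (inner H u e) * rdot (A p) p + N ^+ 2 * rdot (A e) e.
  set c := inner H u e; have [c0|c0] := eqVneq (sqmod c) 0.
    rewrite (sqmod_eq0 c0) scale0r rdotC rdot0l mulr0 addr_ge0//.
      by rewrite mulr_ge0 ?sqmod_ge0.
    by rewrite mulr_ge0// sqr_ge0.
  have cp : 0 < sqmod c by rewrite lt_neqAle eq_sym c0 sqmod_ge0.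
  have := pA (sreal (sqmod c) *: p - sreal N *: (c *: e)).
  have xx : rdot (A (c *: e)) (c *: e) = sqmod c * rdot (A e) e.
    rewrite linear_opZ// /rdot innerZl innerZr mulrA mul_conj.
    by rewrite sre_realM.
  rewrite linear_opB// (linear_opZ _ p lA) (linear_opZ _ (c *: e) lA) !rdotE xx.
  rewrite [rdot (A (c *: e)) p]sA [rdot (c *: e) (A p)]rdotC => h.
  rewrite -(ler_pM2l cp) -subr_ge0; apply: le_trans h _.
  by rewrite le_eqVlt; apply/orP; left; apply/eqP; ring.
have : \sum_(e <- s) 2 * N * rdot (A p) (inner H u e *: e) <=
    \sum_(e <- s) (sqmod (inner H u e) * rdot (A p) p + N ^+ 2 * rdot (A e) e).
  by apply: ler_sum => e _; exact: main.
rewrite -mulr_sumr -rdot_sumr -/p big_split/= -mulr_suml -/(bessel_sum s u) -/N.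
rewrite -mulr_sumr => h.
have [Nz|Nz] := eqVneq N 0.
  have : rnorm p = 0.
    by apply/eqP; rewrite -sqrf_eq0 (rnorm_oproj _ oE sE) -/N Nz.
  by move=> /rnorm0_eq0 ->; rewrite linear_op0// rdot0l Nz mul0r.
have Np : 0 < N by rewrite lt_neqAle eq_sym Nz.
by rewrite -(ler_pM2l Np); lra.
Qed.

(** Here [E] is any orthonormal basis, not one that diagonalizes [A]: the trace is
    defined by an arbitrary choice of basis. *)
Lemma form_le_trace A E u : linear A -> continuous A -> selfadjoint A ->
  (forall u, 0 <= rdot (A u) u) -> orthonormal_basis E -> rnorm u = 1 ->
  ((rdot (A u) u)%:E <= \esum_(e in E) (rdot (A e) e)%:E)%E.
Proof.
move=> lA cA sA pA oE u1; have [s [sE su]] := oproj_cvg u oE.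
have oE' : orthonormal_set E by case: oE.
have Asu : A (oproj (s n) u) @[n --> \oo] --> A u by apply: continuous_cvg; [exact: cA|].
have h n : ((rdot (A (oproj (s n) u)) (oproj (s n) u))%:E <=
    \esum_(e in E) (rdot (A e) e)%:E)%E.
  apply: (@le_trans _ _ (\sum_(e <- s n) (rdot (A e) e)%:E)%E).
    rewrite sumEFin lee_fin; apply: le_trans (form_oproj_le u lA sA pA oE' (sE n)) _.
    rewrite -[leRHS]mul1r ler_wpM2r ?sumr_ge0//.
    by rewrite (rnorm_oproj _ oE' (sE n)) -[1](expr1n _ 2) -u1 (bessel _ oE').
  rewrite (fsbig_seq _ _ (sE n).1); apply: ereal_sup_ubound.
  exists [set` s n] => //; split; first exact: finite_seq.
  by move=> e /= /(sE n).2.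
case: (\esum_(e in E) _)%E h => [r h| |h]; last by have := h 0%N.
  rewrite lee_fin; apply: (cvgr_to_le (rdot_cvg2 Asu su)).
  by near=> n; have := h n; rewrite lee_fin.
by rewrite leey.
Unshelve. all: by end_near. Qed.

End FormsAndTraces.

(** * The spectral theorem for compact self-adjoint operators *)

Section SpectralTheorem.
Context {R : realType} {k : scalar_kind} {H : hilbertSpace R k}.
Implicit Types (u v w : H) (a b : R) (z : scalar R k) (T A B : H -> H).
Implicit Types (E : set H).

Definition orthogonal_to E u := forall e, E e -> inner H u e = 0.

(** A maximizing sequence of the quadratic form on the complement of [E] consists
    of approximate eigenvectors, and compactness makes its images accumulate at
    an eigenvector. The sign [sg] selects the operator, [A] or [- A], whose form
    takes a positive value there. *)
Lemma compact_eigenvector A E u0 (sg : R) : compact_selfadjoint A ->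
  orthonormal_set E -> `|sg| = 1 ->
  (forall u, orthogonal_to E u -> orthogonal_to E (A u)) ->
  orthogonal_to E u0 -> 0 < sg * rdot (A u0) u0 ->
  exists w, [/\ w != 0, orthogonal_to E w & exists l, A w = sreal l *: w].
Proof.
move=> cA oE sg1 EA Eu0 A0.
have lA := compact_selfadjoint_linear cA; have sA := compact_selfadjoint_rdot cA.
have [K K0 bA] := compact_opbound cA.
have Elin a u v : orthogonal_to E u -> orthogonal_to E v ->
    orthogonal_to E (u + sreal a *: v).
  by move=> Eu Ev e Ee; rewrite innerDl innerZl Eu// Ev// mulr0 addr0.
have Escale a u : orthogonal_to E u -> orthogonal_to E (sreal a *: u).
  by move=> Eu e Ee; rewrite innerZl Eu// mulr0.
have u00 : u0 != 0.
  by apply: contraTneq A0 => ->; rewrite linear_op0// rdot0l mulr0 ltxx.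
pose S := [set sg * rdot (A u) u | u in [set u | orthogonal_to E u /\ rnorm u = 1]].
have Su0 : S (sg * rdot (A (sreal (rnorm u0)^-1 *: u0)) (sreal (rnorm u0)^-1 *: u0)).
  by exists (sreal (rnorm u0)^-1 *: u0) => //; split; [exact: Escale|exact: unit_vector].
have hS : has_sup S.
  split; first by eexists; exact: Su0.
  exists K => _ [u /= [_ u1] <-]; apply: le_trans (ler_norm _) _.
  rewrite normrM sg1 mul1r; apply: le_trans (cauchy_schwarz _ _) _.
  by rewrite u1 mulr1; apply: le_trans (bA u) _; rewrite u1 mulr1.
set s := sup S.
have s0 : 0 < s.
  apply: lt_le_trans (ub_le_sup hS.2 Su0).
  rewrite rdot_rnormZ// mulrCA mulr_gt0// exprn_gt0// invr_gt0 rnorm_gt0//.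
pose A' u := sreal sg *: A u.
have lA' : linear A'.
  by move=> z u v; rewrite /A' lA scalerDr !scalerA [sreal sg * z]mulrC.
have sA' : selfadjoint A' by move=> u v; rewrite /A' !rdotE sA.
have bA' : opbound A' K by move=> u; rewrite /A' rnormZr sg1 mul1r.
pose T u := sreal s *: u - A' u.
have lT : linear T by exact: linear_shift.
have sT : selfadjoint T by exact: selfadjoint_shift.
have bT := opbound_shift s bA'.
have pT u : orthogonal_to E u -> 0 <= rdot (T u) u.
  move=> Eu; rewrite rdot_shift subr_ge0.
  have [->|un] := eqVneq u 0.
    by rewrite linear_op0// rdot0l rnorm0 expr0n mulr0.
  have : S (sg * rdot (A (sreal (rnorm u)^-1 *: u)) (sreal (rnorm u)^-1 *: u)).
    by exists (sreal (rnorm u)^-1 *: u) => //; split; [exact: Escale|exact: unit_vector].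
  move=> /(ub_le_sup hS.2); rewrite -/s rdot_rnormZ// exprVn mulrCA mulrC.
  by rewrite ler_pdivrMr ?exprn_gt0 ?rnorm_gt0// /A' rdotZl.
have K'0 : 0 <= `|s| + K by rewrite addr_ge0.
(* The form of [T] is small at near maximizers, hence so is [T]. *)
have approx : forall n, exists u, [/\ orthogonal_to E u, rnorm u = 1 &
    rnorm (T u) <= 2^-1 ^+ n].
  move=> n; have e0 : 0 < (2^-1 ^+ n) ^+ 2 / (`|s| + K + 1).
    by rewrite divr_gt0 ?exprn_gt0 ?invr_gt0// ltr_wpDl.
  have [_ [u /= [Eu u1] <-] h] := sup_adherent e0 hS; exists u; split => //.
  rewrite -(@ler_pXn2r _ 2) ?nnegrE ?rnorm_ge0 ?exprn_ge0 ?invr_ge0//.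
  have ET : orthogonal_to E (T u).
    rewrite /T -scaleN1r -(@sreal1 R k) -srealN; apply: Elin; first exact: Escale.
    exact/Escale/EA.
  have h1 : rnorm (T u) ^+ 2 <= (`|s| + K) * rdot (T u) u.
    by apply: psd_rnorm_sq => // [t|]; apply: pT => //; exact: Elin.
  apply: le_trans h1 _.
  have h2 : rdot (T u) u <= (2^-1 ^+ n) ^+ 2 / (`|s| + K + 1).
    by rewrite rdot_shift u1 expr1n mulr1 /A' rdotZl -/s in h *; lra.
  apply: le_trans (ler_wpM2l K'0 h2) _.
  rewrite mulrCA ger_pMr ?exprn_gt0 ?invr_gt0//.
  by rewrite ler_pdivrMr ?mul1r ?lerDl// ltr_wpDl.
have /choice[x xP] := approx.
have [_ [U AU [cU _]] _] := cA.
have FU : \forall n \near \oo, U (A (x n)).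
  near=> n; apply: AU; exists (x n) => //=; have [_ x1 _] := xP n.
  by rewrite normE x1 sreal1.
have [w [_ cl]] := cU (A (x n) @[n --> \oo]) _ FU.
have close e : 0 < e -> exists n, rnorm (A (x n) - w) < e /\ rnorm (T (x n)) < e.
  move=> e0.
  have Fe : (A (x n) @[n --> \oo]) (A @` [set u | exists2 n, u = x n & rnorm (T u) < e]).
    have h : 2^-1 ^+ n @[n --> \oo] --> (0 : R).
      by apply: cvg_expr; rewrite ger0_norm ?invr_ge0// invf_lt1 ?ltr1n ?ltr0n.
    have /cvgrPdist_lt/(_ e e0) := h; apply: filterS => n.
    rewrite sub0r normrN ger0_norm ?exprn_ge0 ?invr_ge0// => hn.
    exists (x n) => //; exists n => //; apply: le_lt_trans hn.
    by have [] := xP n.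
  have we : nbhs w [set v | rnorm (v - w) < e].
    have : rnorm (v - w) @[v --> w] --> (0 : R) by apply/cvg_rnorm; exact: cvg_id.
    move=> /cvgrPdist_lt/(_ e e0); apply: filterS => v.
    by rewrite sub0r normrN ger0_norm ?rnorm_ge0.
  have [_ [[u /= [n un Te] <-] Aw]] := cl _ _ Fe we.
  by exists n; rewrite -un.
have sgsg : sg * sg = 1 by rewrite -expr2 -(expr1n _ 2) -sg1 -normrX ger0_norm ?sqr_ge0.
(* [A u] is near both [w] and [sg * s *: u]. *)
have close' e : 0 < e -> exists u, [/\ orthogonal_to E u, rnorm u = 1,
    rnorm (A u - w) < e & rnorm (w - sreal (sg * s) *: u) <= 2 * e].
  move=> e0; have [n [h1 h2]] := close e e0; have [h3 h4 _] := xP n.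
  exists (x n); split => //; rewrite -(subrKA (A (x n))).
  apply: le_trans (rnormD _ _) _; rewrite rnormB.
  have -> : A (x n) - sreal (sg * s) *: x n = - (sreal sg *: T (x n)).
    by rewrite /T /A' scalerBr !scalerA -!srealM sgsg sreal1 scale1r opprB.
  by rewrite rnormN rnormZr sg1 mul1r; lra.
have small (a C : R) : 0 <= a -> 0 <= C -> (forall e, 0 < e -> a <= C * e) -> a = 0.
  move=> a0 C0 h; apply/le_anti; rewrite a0 andbT; apply/ler_addgt0Pl => e e0.
  rewrite addr0; have C1 : 0 < C + 1 by rewrite ltr_wpDl.
  apply: le_trans (h (e / (C + 1)) _) _; first by rewrite divr_gt0.
  by rewrite mulrCA ger_pMr// ler_pdivrMr ?mul1r ?lerDl.
exists w; split.
- apply/eqP => w0; suff : s = 0 by move=> s00; rewrite s00 ltxx in s0.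
  apply: (small s 2) => //; first exact: ltW.
  move=> e e0; have [u [_ u1 _]] := close' e e0.
  rewrite w0 sub0r rnormN rnormZr u1 mulr1 normrM sg1 mul1r ger0_norm//; exact: ltW.
- move=> e Ee; apply/eqP; rewrite -normr_eq0 (ge0_sreal (normr_ge0 _)).
  suff -> : sre `|inner H w e| = 0 by rewrite sreal0.
  apply: (small _ 2) => //; first by rewrite -(@sreal_le R k) sreal0 -ge0_sreal.
  move=> d d0; have [u [Eu u1 _ h]] := close' d d0; apply: le_trans h.
  have -> : inner H w e = inner H (w - sreal (sg * s) *: u) e.
    by rewrite innerBl innerZl Eu// mulr0 subr0.
  exact: norm_inner_le oE Ee.
- exists (sg * s); apply/subr0_eq/rnorm0_eq0.
  apply: (small _ (2 * K + s)); first exact: rnorm_ge0.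
    by rewrite addr_ge0 ?mulr_ge0// ltW.
  move=> d d0; have [u [Eu u1 h1 h2]] := close' d d0.
  rewrite -(subrKA (A (sreal (sg * s) *: u))).
  apply: le_trans (rnormD _ _) _; rewrite -linear_opB// (linear_opZ _ u lA) -scalerBr.
  rewrite rnormZr normrM sg1 mul1r ger0_norm ?(ltW s0)// mulrDl; apply: lerD.
    by apply: le_trans (bA _) _; rewrite mulrAC [leRHS]mulrC ler_wpM2l.
  by rewrite ler_pM2l// ltW.
Unshelve. all: by end_near. Qed.

Definition eigen_set A E := orthonormal_set E /\
  forall e, E e -> exists l, A e = sreal l *: e.

(** A maximal orthonormal set of eigenvectors has trivial orthogonal complement:
    if the form of [A] vanishes on the complement then so does [A], and any vector
    there is an eigenvector; otherwise [compact_eigenvector] provides one. *)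
Theorem spectral_theorem A : compact_selfadjoint A ->
  exists E (l : H -> R), orthonormal_basis E /\ diagonal A E l.
Proof.
move=> cA.
have lA := compact_selfadjoint_linear cA; have sA := compact_selfadjoint_rdot cA.
have [K K0 bA] := compact_opbound cA.
have [F Fe Ft|E [[oE eE] maxE]] := @Zorn_bigcup H (eigen_set A).
  split; last by move=> e [X FX Xe]; have [_] := Fe _ FX; exact.
  split; first by move=> e [X FX Xe]; have [[+ _] _] := Fe _ FX; exact.
  move=> e e' [X FX Xe] [Y FY Ye']; have [XY|YX] := Ft _ _ FX FY.
    by have [[_ +] _] := Fe _ FY; apply => //; exact: XY.
  by have [[_ +] _] := Fe _ FX; apply => //; exact: YX.
have /choice[l lP] : forall e, exists l, E e -> A e = sreal l *: e.
  move=> e; case: (pselect (E e)) => [/eE[l Al]|nE]; first by exists l.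
  by exists 0.
exists E, l; split=> //; split; [exact: oE.1|exact: oE.2|].
move=> u Eu; apply: contrapT => /eqP u0.
have EA v : orthogonal_to E v -> orthogonal_to E (A v).
  move=> Ev e Ee; have [_ _ sAi] := cA.
  by rewrite sAi lP// innerZr Ev// mulr0.
have [w [w0 Ew [m Am]]] : exists w, [/\ w != 0, orthogonal_to E w &
    exists l, A w = sreal l *: w].
  case: (pselect (exists2 v, orthogonal_to E v & rdot (A v) v != 0)).
    move=> [v Ev Av].
    apply: (@compact_eigenvector A E v (Num.sg (rdot (A v) v))) => //.
      by rewrite normr_sg Av.
    by rewrite -normrEsg normr_gt0.
  move=> nz; exists u; split => //; exists 0; rewrite sreal0 scale0r.
  have z v : orthogonal_to E v -> rdot (A v) v = 0.
    by move=> Ev; apply/eqP/negP => /negP h; apply: nz; exists v.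
  apply/rnorm0_eq0/eqP; rewrite -sqrf_eq0; apply/eqP/le_anti; rewrite sqr_ge0 andbT.
  rewrite -(mulr0 K) -(z u Eu); apply: psd_rnorm_sq => // [t|].
    rewrite z// => e Ee; rewrite innerDl innerZl Eu// EA// mulr0 addr0//.
  by rewrite z//; exact: EA.
pose e0 := sreal (rnorm w)^-1 *: w.
have Ee0 : orthogonal_to E e0 by move=> e Ee; rewrite innerZl Ew// mulr0.
have e01 : inner H e0 e0 = 1.
  by rewrite -inner_norm normE unit_vector// sreal1 expr1n.
have nEe0 : ~ E e0.
  by move=> /Ee0 /eqP; rewrite e01 oner_eq0.
apply: (maxE (E `|` [set e0])).
  by split=> [|h]; [exact: subsetUl|apply: nEe0; apply: h; right].
split; first split.
- by move=> e [/oE.1|->].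
- move=> e e' [Ee|->] [Ee'|->] ee' //.
  + exact: oE.2.
  + by rewrite innerC Ee0// -(@sreal0 R k) sreal_conj.
  + exact: Ee0.
- move=> e [/eE//|->]; exists m.
  by rewrite /e0 linear_opZ// Am !scalerA mulrC.
Qed.

End SpectralTheorem.

(** * Functional calculus and Jensen's inequality *)

Section ExpOperator.
Context {R : realType} {k : scalar_kind} {H : hilbertSpace R k}.
Implicit Types (u v w : H) (a b : R) (z : scalar R k) (T A B : H -> H).
Implicit Types (E : set H).

Definition exp_partial A n u : H := \sum_(0 <= i < n) sreal (i`!%:R^-1) *: iter i A u.
Definition opexp A u : H := lim (exp_partial A n u @[n --> \oo]).

Section Bounded.
Variables (A : H -> H) (K : R).
Hypotheses (lA : linear A) (bA : opbound A K) (K0 : 0 <= K).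

Let linear_iter i : linear (iter i A).
Proof. by elim: i => [|i IH] z u v //=; rewrite IH lA. Qed.

Let iter_bound i u : rnorm (iter i A u) <= K ^+ i * rnorm u.
Proof.
elim: i => [|i IH] /=; first by rewrite expr0 mul1r.
by apply: le_trans (bA _) _; rewrite exprS -mulrA ler_wpM2l.
Qed.

Let term_bound i u : rnorm (sreal (i`!%:R^-1) *: iter i A u) <= exp_coeff K i * rnorm u.
Proof.
rewrite rnormZr ger0_norm ?invr_ge0// /exp_coeff/= mulrAC [leRHS]mulrC.
by rewrite ler_wpM2l ?invr_ge0// iter_bound.
Qed.

Lemma exp_partial_cvg u : exp_partial A n u @[n --> \oo] --> opexp A u.
Proof.
apply: (@summable_cvg _ _ _ _ (fun n => rnorm u * exp_coeff K n)).
  have -> : series (fun n => rnorm u * exp_coeff K n) =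
            (fun n => rnorm u * series (exp_coeff K) n).
    by apply/funext => n; rewrite /series/= mulr_sumr.
  by apply: is_cvgM; [exact: is_cvg_cst|exact: is_cvg_series_exp_coeff].
move=> n; rewrite /exp_partial big_nat_recr//= addrAC subrr add0r mulrC.
exact: term_bound.
Qed.

Lemma opexp_linear : linear (opexp A).
Proof.
move=> z u v.
have h1 : z *: exp_partial A n u + exp_partial A n v @[n --> \oo] -->
    z *: opexp A u + opexp A v.
  by apply: cvgD; [apply: cvgZr|]; exact: exp_partial_cvg.
have h2 := @exp_partial_cvg (z *: u + v).
apply: (@cvg_unique _ (@norm_hausdorff _ H) _ _ _ _ h2).
suff -> : exp_partial A ^~ (z *: u + v) =
    (fun n => z *: exp_partial A n u + exp_partial A n v) by [].
apply/funext => n; rewrite /exp_partial scaler_sumr -big_split/=.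
apply: eq_bigr => i _; rewrite linear_iter scalerDr; congr (_ + _).
by rewrite !scalerA mulrC.
Qed.

Lemma opexp_bound : opbound (opexp A) (expR K).
Proof.
move=> u; have h : rnorm (exp_partial A n u) @[n --> \oo] --> rnorm (opexp A u).
  by apply: continuous_cvg (@exp_partial_cvg u); exact: continuous_rnorm.
apply: (cvgr_to_le h); near=> n.
apply: (@le_trans _ _ (series (exp_coeff K) n * rnorm u)).
  rewrite /series/= mulr_suml /exp_partial.
  elim/big_ind2 : _ => [|x a y b xa yb|i _]; first by rewrite rnorm0.
    by apply: le_trans (rnormD _ _) _; exact: lerD.
  exact: term_bound.
rewrite ler_wpM2r ?rnorm_ge0//; apply: nondecreasing_cvgn_le.
  by apply: nondecreasing_series => i _ _; exact: exp_coeff_ge0.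
exact: is_cvg_series_exp_coeff.
Unshelve. all: by end_near. Qed.

(** On an eigenvector the operator series is the scalar exponential series. *)
Lemma opexp_eigen l e : A e = sreal l *: e -> opexp A e = sreal (expR l) *: e.
Proof.
move=> Ae; have h := @exp_partial_cvg e.
apply: (@cvg_unique _ (@norm_hausdorff _ H) _ _ _ _ h).
have Ai i : iter i A e = sreal (l ^+ i) *: e.
  elim: i => [|i IH]; first by rewrite expr0 sreal1 scale1r.
  by rewrite /= IH linear_opZ// Ae scalerA -srealM exprSr.
apply/cvg_rnorm.
have -> : (fun n => rnorm (exp_partial A n e - sreal (expR l) *: e)) =
    (fun n => `|series (exp_coeff l) n - expR l| * rnorm e).
  apply/funext => n; rewrite -rnormZr srealD srealN scalerBl; congr (rnorm (_ - _)).
  rewrite /exp_partial /series/= (big_morph _ (@srealD R k) (@sreal0 R k)) scaler_suml.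
  by apply: eq_bigr => i _; rewrite Ai scalerA -srealM mulrC.
rewrite -(mul0r (rnorm e)); apply: cvgM; last exact: cvg_cst.
have : (series (exp_coeff l) n - expR l) @[n --> \oo] --> expR l - expR l.
  by apply: cvgB; [exact: is_cvg_series_exp_coeff|exact: cvg_cst].
by rewrite subrr => /cvg_norm; rewrite normr0.
Qed.

End Bounded.

Lemma bounded_operatorE A : linear A -> (exists K, opbound A K) -> bounded_operator A.
Proof. by move=> lA [K bA]; split => //; exact: opbound_continuous bA. Qed.

Lemma opbound_lin A B K L a b : opbound A K -> opbound B L ->
  opbound (fun u => sreal a *: A u + sreal b *: B u) (`|a| * K + `|b| * L).
Proof.
move=> bA bB u; apply: le_trans (rnormD _ _) _; rewrite !rnormZr mulrDl -!mulrA.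
by apply: lerD; apply: ler_wpM2l.
Qed.

Lemma linear_lin A B a b : linear A -> linear B ->
  linear (fun u => sreal a *: A u + sreal b *: B u).
Proof.
move=> lA lB z u v; rewrite lA lB !scalerDr !scalerA [z * _]mulrC [z * sreal b]mulrC.
by rewrite addrACA.
Qed.

(** Functional calculus for the linear combinations of [exp], [exp \o -], the
    identity and a constant, among which are the two functions of the theorem. *)
Lemma spectral_fun_exp A (a b c m : R) : compact_selfadjoint A ->
  exists B, spectral_fun (fun x => a * expR x + b * expR (- x) + c * x + m) A B.
Proof.
move=> cA; have lA := compact_selfadjoint_linear cA.
have [K K0 bA] := compact_opbound cA.
have [E [l [oE dA]]] := spectral_theorem cA.
pose NA u := - A u.
have lN : linear NA by move=> z u v; rewrite /NA lA opprD scalerN.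
have bN : opbound NA K by move=> u; rewrite /NA rnormN.
have bid : opbound (@idfun H) 1 by move=> u; rewrite mul1r.
have lid : linear (@idfun H) by [].
pose B1 u := sreal a *: opexp A u + sreal b *: opexp NA u.
pose B2 u := sreal c *: A u + sreal m *: idfun u.
have lB1 : linear B1 by apply: linear_lin; [exact: opexp_linear bA K0|exact: opexp_linear bN K0].
have lB2 : linear B2 by exact: linear_lin.
have bB1 := opbound_lin a b (opexp_bound bA K0) (opexp_bound bN K0).
have bB2 := opbound_lin c m bA bid.
have bB := opbound_lin 1 1 bB1 bB2; have lB := linear_lin 1 1 lB1 lB2.
exists (fun u => sreal 1 *: B1 u + sreal 1 *: B2 u); split.
  by apply: bounded_operatorE => //; eexists; exact: bB.
exists E, l; split => // e Ee; split; first exact: dA.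
rewrite /B1 /B2 (opexp_eigen lA bA K0 (dA _ Ee)).
have Ne : NA e = sreal (- l e) *: e by rewrite /NA dA// srealN scaleNr.
rewrite (opexp_eigen lN bN K0 Ne) dA// sreal1 !scale1r /idfun !scalerA -!scalerDl.
by rewrite -!srealM -!srealD !addrA.
Qed.

(** Jensen's inequality for the spectral measure of [A] at [u]: with [y] the value
    of the form at [u], the operator [C = f(A) - f y - b (A - y)] is diagonal with
    nonnegative eigenvalues, as the line of slope [b] at [y] lies below [f]. The
    form of [f(A)] is in turn dominated by the trace. *)
Lemma optrace_ge A (f : R -> R) u : compact_selfadjoint A ->
  (exists B, spectral_fun f A B) -> (forall x, 0 <= f x) ->
  (forall y, exists b, forall x, f y + b * (x - y) <= f x) ->
  rnorm u = 1 ->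
  ((f (rdot (A u) u))%:E <= optrace (opfun f A))%E.
Proof.
move=> cA [B0 hB0] f0 ft u1; rewrite /optrace.
have lA := compact_selfadjoint_linear cA; have [K K0 bA] := compact_opbound cA.
have cA' := opbound_continuous lA bA.
have oE' : orthonormal_basis (xget set0 (@orthonormal_basis R k H)).
  have [E [l [oE _]]] := spectral_theorem cA.
  by apply: xgetPex; exists E.
have : spectral_fun f A (opfun f A) by apply: xgetPex; exists B0.
move: (opfun f A) => B [[lB cB] [E [l [oE dE]]]].
have dB : diagonal B E (fun e => f (l e)) by move=> e /dE[].
have dA : diagonal A E l by move=> e /dE[].
have pB := diagonal_psd lB cB oE dB (fun e _ => f0 (l e)).
have sB := diagonal_selfadjoint lB cB oE dB.
apply: le_trans (form_le_trace lB cB sB pB oE' u1); rewrite lee_fin.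
have [b hb] := ft (rdot (A u) u); set y := rdot (A u) u in hb *.
pose C v := sreal 1 *: B v + sreal 1 *: (sreal (- b) *: A v + sreal (b * y - f y) *: v).
have [L L0 bB] := continuous_opbound lB cB.
have lid : linear (@idfun H) by [].
have lD := linear_lin (- b) (b * y - f y) lA lid.
have bid : opbound (@idfun H) 1 by move=> v; rewrite mul1r.
have lC : linear C by exact: linear_lin lB lD.
have bC := opbound_lin 1 1 bB (opbound_lin (- b) (b * y - f y) bA bid).
have dC : diagonal C E (fun e => f (l e) + (- b * l e + (b * y - f y))).
  move=> e Ee; rewrite /C dB// dA// sreal1 !scale1r scalerA -scalerDl -scalerDl.
  by rewrite -srealM -!srealD.
have := diagonal_psd lC (opbound_continuous lC bC) oE dC.
have h e : E e -> 0 <= f (l e) + (- b * l e + (b * y - f y)).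
  by move=> _; have := hb (l e); lra.
move=> /(_ h u); rewrite /C sreal1 !scale1r !rdotE rdotuu u1 -/y expr1n.
lra.
Qed.

Lemma optrace_ge0 A (f : R -> R) : compact_selfadjoint A ->
  (exists B, spectral_fun f A B) -> (forall x, 0 <= f x) ->
  (0 <= optrace (opfun f A))%E.
Proof.
move=> cA [B0 hB0] f0; rewrite /optrace.
have : spectral_fun f A (opfun f A) by apply: xgetPex; exists B0.
move: (opfun f A) => B [[lB cB] [E [l [oE dE]]]].
apply: esum_ge0 => e _; rewrite lee_fin.
have dB : diagonal B E (fun e => f (l e)) by move=> e' /dE[].
exact: (diagonal_psd lB cB oE dB (fun e _ => f0 (l e))).
Qed.

End ExpOperator.

(** * Convexity of the two functions *)

Section ExpFunctions.
Context {R : realType}.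
Implicit Types x y : R.

Lemma phi_ge0 x : 0 <= phi x.
Proof. by have := expR_ge1Dx x; rewrite /phi; lra. Qed.

(** From [exp x = exp y exp (x - y)] and [exp (x - y) >= 1 + (x - y)]. *)
Lemma phi_tangent y x : phi y + (expR y - 1) * (x - y) <= phi x.
Proof.
have h : expR x = expR y * expR (x - y) by rewrite -expRD subrKC.
have h2 : expR y * (1 + (x - y)) <= expR y * expR (x - y).
  by rewrite ler_pM2l ?expR_gt0// expR_ge1Dx.
by rewrite /phi h; lra.
Qed.

Lemma varphiE x : varphi x = (phi x + phi (- x)) / 2.
Proof. by rewrite /varphi /cosh /phi; field. Qed.

Lemma varphi_ge0 x : 0 <= varphi x.
Proof. by rewrite varphiE; have := phi_ge0 x; have := phi_ge0 (- x); lra. Qed.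

Lemma varphi_tangent y x :
  varphi y + (expR y - expR (- y)) / 2 * (x - y) <= varphi x.
Proof.
have := phi_tangent y x; have := phi_tangent (- y) (- x).
by rewrite !varphiE; lra.
Qed.

Lemma measurable_phi : measurable_fun setT (phi : R -> R).
Proof.
by apply: measurable_funB => //; apply: measurable_funB.
Qed.

Lemma measurable_varphi : measurable_fun setT (varphi : R -> R).
Proof.
apply: measurable_funB => //; rewrite /cosh; apply: measurable_funM => //.
by apply: measurable_funD => //; apply: measurableT_comp.
Qed.

Lemma tangent_phi_ge0 (y : R) : 0 <= y ->
  exists2 b, 0 <= b & forall x, phi y + b * (x - y) <= phi x.
Proof.
by move=> y0; exists (expR y - 1); [rewrite subr_ge0 -expR0 ler_expR|exact: phi_tangent].
Qed.

Lemma tangent_varphi_ge0 (y : R) : 0 <= y ->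
  exists2 b, 0 <= b & forall x, varphi y + b * (x - y) <= varphi x.
Proof.
move=> y0; exists ((expR y - expR (- y)) / 2); last exact: varphi_tangent.
by rewrite divr_ge0// subr_ge0 ler_expR; lra.
Qed.

Lemma varphiN (x : R) : varphi (- x) = varphi x.
Proof. by rewrite /varphi /cosh opprK [_ + expR x]addrC. Qed.

Lemma varphi_sign m (x : R) : varphi ((-1) ^+ m * x) = varphi x.
Proof. by rewrite -signr_odd; case: odd; rewrite /= ?expr0 ?expr1 ?mul1r// mulN1r varphiN. Qed.

End ExpFunctions.

(** * The space of compact self-adjoint operators *)

Section CompactOperators.
Context {R : realType} {k : scalar_kind} {H : hilbertSpace R k}.
Implicit Types (A B : H -> H) (u v : H).

Lemma compact_selfadjoint0 : compact_selfadjoint (0 : H -> H).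
Proof.
split; first by move=> z u v; rewrite [RHS]addr0 [RHS]scaler0.
  exists [set 0]; first by move=> _ [u _ <-].
  by split; [|apply: compact_closed; first exact: norm_hausdorff]; exact: compact_set1.
by move=> u v; rewrite [LHS]linear0l [RHS]linear0r.
Qed.

(** The image of the unit ball lies in the image by addition of a product of two
    compact sets. *)
Lemma compact_selfadjointD A B : compact_selfadjoint A -> compact_selfadjoint B ->
  compact_selfadjoint (A + B).
Proof.
move=> [lA [U AU [cU clU]] sA] [lB [V BV [cV clV]] sB]; split.
- by move=> z u v; rewrite !fctE lA lB scalerDr addrACA.
- pose W := (fun z : H * H => z.1 + z.2) @` (U `*` V).
  have cW : compact W.
    apply: continuous_compact; last exact: compact_setX.
    by apply: continuous_subspaceT; exact: add_continuous.
  exists W; last by split => //; apply: compact_closed => //; exact: norm_hausdorff.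
  move=> _ [u u1 <-]; exists (A u, B u) => //; split => /=.
    by apply: AU; exists u.
  by apply: BV; exists u.
- by move=> u v; rewrite !fctE innerDl sA sB; apply/esym; exact: linearDr.
Qed.

Lemma compact_selfadjointZ A a : compact_selfadjoint A ->
  compact_selfadjoint (sreal a *: A).
Proof.
move=> [lA [U AU [cU clU]] sA]; split.
- by move=> z u v; rewrite !fctE lA scalerDr !scalerA [sreal a * z]mulrC.
- pose W := (fun z : H => sreal a *: z) @` U.
  have cW : compact W.
    apply: continuous_compact => //; apply: continuous_subspaceT.
    exact: scaler_continuous.
  exists W; last by split => //; apply: compact_closed => //; exact: norm_hausdorff.
  by move=> _ [u u1 <-]; exists (A u) => //; apply: AU; exists u.
- by move=> u v; rewrite !fctE innerZl innerZr sreal_conj sA.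
Qed.

Lemma compact_selfadjoint_sum I (r : seq I) (P : pred I) (F : I -> H -> H) :
  (forall i, compact_selfadjoint (F i)) ->
  compact_selfadjoint (\sum_(i <- r | P i) F i).
Proof.
move=> cF; elim/big_ind : _ => //; first exact: compact_selfadjoint0.
by move=> A B; exact: compact_selfadjointD.
Qed.

(** Because [|<(B - A) u, u>| <= opnorm (B - A) |u|^2]. *)
Lemma op_open_form_gt u c : op_open [set A | c < rdot (A u) u].
Proof.
move=> A cA /= cAu; pose e := (rdot (A u) u - c) / (rnorm u ^+ 2 + 1).
have p1 : 0 < rnorm u ^+ 2 + 1 by rewrite ltr_wpDl ?sqr_ge0.
exists e; first by rewrite divr_gt0// subr_gt0.
move=> B cB BA /=.
have [K K0 bA] := compact_opbound cA; have [L L0 bB] := compact_opbound cB.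
have bBA : opbound (B - A) (L + K).
  move=> v; rewrite !fctE; apply: le_trans (rnormD _ _) _.
  by rewrite rnormN mulrDl lerD.
have lBA : linear (B - A).
  move=> z v w; rewrite !fctE (compact_selfadjoint_linear cA) (compact_selfadjoint_linear cB).
  by rewrite scalerBr opprD addrACA.
have h1 := opbound_opnorm bBA (addr_ge0 L0 K0) lBA u.
have h2 : `|rdot (B u) u - rdot (A u) u| <= opnorm (B - A) * rnorm u ^+ 2.
  rewrite -rdotBl; apply: le_trans (cauchy_schwarz _ _) _.
  by rewrite expr2 mulrA ler_wpM2r// rnorm_ge0.
have h3 : opnorm (B - A) * rnorm u ^+ 2 <= e * rnorm u ^+ 2.
  by rewrite ler_wpM2r ?sqr_ge0// ltW.
have h4 : e * rnorm u ^+ 2 < rdot (A u) u - c.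
  rewrite -[ltRHS](@divfK _ (rnorm u ^+ 2 + 1)) ?gt_eqF// -/e.
  by rewrite ltr_pM2l ?ltrDl// divr_gt0// subr_gt0.
by move: h2; rewrite ler_norml => /andP[h2 _]; lra.
Qed.

Lemma measurable_form u :
  measurable_fun setT (fun A : g_sigma_algebraType (@op_open R k H) => rdot (A u) u).
Proof.
apply: (measurability _ (RGenOInfty.measurableE R)) => _ [_ [c ->] <-].
rewrite setTI; apply: sub_sigma_algebra.
have := @op_open_form_gt u c; congr (op_open _); apply/seteqP; split => A /=.
  by rewrite in_itv/= andbT.
by rewrite in_itv/= andbT.
Qed.

End CompactOperators.

(** * Integrals over an independent event *)

Section IndependentEvent.
Context d {Omega : measurableType d} {R : realType} (P : probability Omega R).
Local Open Scope ereal_scope.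

Lemma integral_mrestr (A : set Omega) (mA : measurable A) (g : Omega -> \bar R) :
  measurable_fun setT g -> (forall w, 0 <= g w) ->
  \int[mrestr P mA]_w g w = \int[P]_(w in A) g w.
Proof.
move=> mg g0; rewrite -{1}(setUv A) ge0_integral_setU//=; last 3 first.
- exact: measurableC.
- exact: measurable_funTS.
- by rewrite disj_set2E setICr.
rewrite (@eq_measure_integral _ _ _ (~` A) mzero); last first.
  move=> B mB BA; rewrite /= /mrestr/= (_ : B `&` A = set0) ?measure0//.
  by apply/disjoints_subset.
rewrite integral_measure_zero adde0; apply: eq_measure_integral => B mB BA.
by rewrite /= /mrestr/= setIidl.
Qed.

(** Under [P] restricted to [A], the law of [Y] is [P A] times its law under [P]. *)
Lemma ge0_integral_indep A (Y : Omega -> R) (f : R -> \bar R) : measurable A ->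
  measurable_fun setT Y ->
  (forall B, measurable B -> P (A `&` Y @^-1` B) = P A * P (Y @^-1` B)) ->
  measurable_fun setT f -> (forall y, 0 <= f y) ->
  \int[P]_(w in A) f (Y w) = P A * \int[P]_w f (Y w).
Proof.
move=> mA mY ind mf f0.
have mfY : measurable_fun setT (f \o Y) by exact: measurableT_comp mf mY.
rewrite -(integral_mrestr mA mfY (fun w => f0 (Y w))).
rewrite -[in LHS](preimage_setT Y) -(ge0_integral_pushforward mY)//=.
pose c := NngNum (fine_ge0 (measure_ge0 P A)).
have PA : (c%:num)%:E = P A by rewrite /= fineK// fin_num_measure.
rewrite (@eq_measure_integral _ _ _ setT (mscale c (pushforward P Y))); last first.
  move=> B mB _; rewrite /= /mscale/= /pushforward/= /mrestr.
  by rewrite setIC ind// fineK// fin_num_measure.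
rewrite ge0_integral_mscale//= PA ge0_integral_pushforward//.
Qed.

Lemma integral_indep_eq0 A (Y : Omega -> R) : measurable A ->
  P.-integrable setT (EFin \o Y) -> \int[P]_w (Y w)%:E = 0 ->
  (forall B, measurable B -> P (A `&` Y @^-1` B) = P A * P (Y @^-1` B)) ->
  \int[P]_(w in A) (Y w)%:E = 0.
Proof.
move=> mA iY Y0 ind.
have mY : measurable_fun setT Y by apply/measurable_EFinP; case/integrableP: iY.
have mp : measurable_fun setT (EFin : R -> \bar R)^\+ by exact: measurable_funepos.
have mn : measurable_fun setT (EFin : R -> \bar R)^\- by exact: measurable_funeneg.
have fp := integrable_pos_fin_num measurableT iY.
have fn := integrable_neg_fin_num measurableT iY.
have e1 : \int[P]_(w in A) (EFin \o Y)^\+ w = P A * \int[P]_w (EFin \o Y)^\+ w.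
  have := ge0_integral_indep mA mY ind mp.
  by rewrite !funepos.unlock; apply => y; rewrite le_max lexx orbT.
have e2 : \int[P]_(w in A) (EFin \o Y)^\- w = P A * \int[P]_w (EFin \o Y)^\- w.
  have := ge0_integral_indep mA mY ind mn.
  by rewrite !funeneg.unlock; apply => y; rewrite le_max lexx orbT.
rewrite (integralE _ A (EFin \o Y)) e1 e2.
have PA := fin_num_measure P A mA.
rewrite -muleBr// ; last exact: fin_num_adde_defr.
by rewrite -(integralE _ setT (EFin \o Y)) Y0 mule0.
Qed.

End IndependentEvent.

(** * The past of a sequence of independent variables *)

Section Past.
Context d d' {Omega : measurableType d} {T : measurableType d'} {R : realType}.
Variables (P : probability Omega R) (n : nat) (X : 'I_n -> Omega -> T).
Hypothesis mX : forall j, measurable_fun setT (X j).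
Hypothesis indX : forall (J : {set 'I_n}) (B : 'I_n -> set T),
  (forall j, j \in J -> measurable (B j)) ->
  P (\bigcap_(j in [set` J]) (X j @^-1` B j)) = (\prod_(j in J) P (X j @^-1` B j))%E.

(** A pi-system that generates the sigma-algebra of the variables [X j], [j < i]. Every
    such [j] occurs, possibly with [B j = setT], which makes intersections simple. *)
Definition past_events (i : nat) : set (set Omega) :=
  [set \bigcap_(j in [set j : 'I_n | (j < i)%N]) (X j @^-1` B j) |
    B in [set B : 'I_n -> set T | forall j, measurable (B j)]].

Lemma past_events_setI i : setI_closed (past_events i).
Proof.
move=> _ _ [B mB <-] [C mC <-]; exists (fun j => B j `&` C j).
  by move=> j; exact: measurableI.
by rewrite -bigcapI.
Qed.

Lemma past_events_measurable i A : past_events i A -> measurable A.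
Proof.
move=> [B mB <-]; apply: fin_bigcap_measurable.
  exact: finite_finset.
by move=> j _; rewrite -[X in measurable X]setTI; exact: mX.
Qed.

(** Independence provides the product formula on the pi-system, and Dynkin's theorem
    extends it to the generated sigma-algebra. *)
Lemma past_indep i (l : 'I_n) A B : (i <= l)%N -> <<s past_events i >> A ->
  measurable B ->
  measurable A /\ P (A `&` X l @^-1` B) = (P A * P (X l @^-1` B))%E.
Proof.
move=> il + mB; rewrite -setI_closed_g_dynkin_g_sigma_algebra; last exact: past_events_setI.
set C := X l @^-1` B.
have mC : measurable C by rewrite -[X in measurable X]setTI; exact: mX.
move=> /(_ [set A0 | measurable A0 /\ P (A0 `&` C) = (P A0 * P C)%E]); apply; split; last first.
  move=> A' pA'; split; first exact: past_events_measurable pA'.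
  case: pA' => B' mB' <-.
  pose J := [set j : 'I_n | (j < i)%N]%SET.
  have lJ : l \notin J by rewrite inE -leqNgt.
  have JE : [set j : 'I_n | (j < i)%N] = [set` J].
    by apply/seteqP; split => j /=; rewrite inE.
  rewrite JE indX; last by move=> j _; exact: mB'.
  pose B2 j := if j == l then B else B' j.
  have -> : \bigcap_(j in [set` J]) X j @^-1` B' j `&` C =
      \bigcap_(j in [set` (l |: J)%SET]) X j @^-1` B2 j.
    apply/seteqP; split => [w [h1 h2] j /=|w h].
      rewrite !inE /B2 => /orP[/eqP ->|jJ]; first by rewrite eqxx.
      case: eqP => [->//|_]; apply: h1; by rewrite /= inE.
    split; last by have := h l; rewrite /= !inE eqxx /B2 eqxx; exact.
    move=> j /= jJ; have := h j; rewrite /= inE jJ orbT /B2 => /(_ isT).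
    by case: eqP => // jl; move: lJ; rewrite -jl jJ.
  rewrite indX; last first.
    by move=> j _; rewrite /B2; case: eqP => _ //; exact: mB'.
  rewrite big_setU1//= {1}/B2 eqxx muleC; congr (_ * _)%E.
  apply: eq_bigr => j jJ; rewrite /B2; case: eqP => // jl.
  by move: lJ; rewrite -jl jJ.
split.
- by split=> //; rewrite setTI probability_setT mul1e.
- move=> A' [mA' h]; split; first exact: measurableC.
  have e1 : P (~` A' `&` C) = (P C - P (A' `&` C))%E.
    by rewrite setIC -setDE measureD// ?fin_num_measure// ?(setIC C)// -ge0_fin_numE// fin_num_measure.
  rewrite e1 h probability_setC// muleBl ?mul1e// ?fin_num_measure//.
- move=> F tF hF.
  have mF k : measurable (F k) by case: (hF k).
  split; first exact: bigcup_measurable.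
  rewrite setI_bigcupl measure_semi_bigcup//; last 3 first.
  + by move=> k; exact: measurableI.
  + by apply/trivIsetP => a b _ _ ab; rewrite setIACA (trivIsetP.1 tF)// set0I.
  + by apply: bigcup_measurable => k _; exact: measurableI.
  rewrite measure_semi_bigcup//; last exact: bigcup_measurable.
  have PC : P C = (fine (P C))%:E by rewrite fineK// fin_num_measure.
  rewrite muleC PC -nneseriesZl//; apply: eq_eseriesr => k _.
  by have [_ hk] := hF k; rewrite -PC muleC; exact: hk.
Qed.

Lemma past_measurable_fun i (j : 'I_n) (L : T -> R) : (j < i)%N ->
  measurable_fun setT L ->
  measurable_fun setT (fun w : g_sigma_algebraType (past_events i) => L (X j w)).
Proof.
move=> ji mL _ B mB; rewrite setTI; apply: sub_sigma_algebra.
exists (fun j' => if j' == j then L @^-1` B else setT).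
  move=> j' /=; case: eqP => // _; rewrite -[X in measurable X]setTI; exact: mL.
apply/seteqP; split => [w /(_ j ji)|w h j' /=]; first by rewrite eqxx.
by case: eqP => // ->.
Qed.

End Past.

(** * A maximal inequality for a family of random walks *)

Section MaximalInequality.
Context d d' {Omega : measurableType d} {T : measurableType d'} {R : realType}.
Variables (P : probability Omega R) (n : nat) (X : 'I_n -> Omega -> T).
Hypothesis mX : forall j, measurable_fun setT (X j).
Hypothesis indX : forall (J : {set 'I_n}) (B : 'I_n -> set T),
  (forall j, j \in J -> measurable (B j)) ->
  P (\bigcap_(j in [set` J]) (X j @^-1` B j)) = (\prod_(j in J) P (X j @^-1` B j))%E.
Variable L : nat -> T -> R.
Hypothesis mL : forall m, measurable_fun setT (L m).
Hypothesis iL : forall m j, P.-integrable setT (fun w => (L m (X j w))%:E).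
Hypothesis L0 : forall m j, (\int[P]_w (L m (X j w))%:E = 0)%E.
Variable G : Omega -> \bar R.
Hypothesis mG : measurable_fun setT G.
Hypothesis G0 : forall w, (0 <= G w)%E.

Definition walk m i w : R := \sum_(j < n | (j < i)%N) L m (X j w).

Lemma measurable_walk_gt i m (y : R) : measurable [set w | y < walk m i w].
Proof.
have : measurable_fun setT (fun w => walk m i w).
  under eq_fun do rewrite /walk big_mkcond.
  apply: measurable_sum => j; case ji : (j < i)%N; last exact: measurable_cst.
  by apply/measurable_EFinP; case/integrableP: (iL m j).
move=> /(_ measurableT _ (measurable_itv `]y, +oo[)); rewrite setTI.
by congr (measurable _); apply/seteqP; split => w /=; rewrite in_itv/= andbT.
Qed.

Lemma integral_past_eq0 i m (j : 'I_n) A : <<s past_events X i >> A -> (i <= j)%N ->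
  (\int[P]_(w in A) (L m (X j w))%:E = 0)%E.
Proof.
move=> sA ij; have [mA _] := past_indep mX indX ij sA measurableT.
apply: (integral_indep_eq0 mA (iL m j) (L0 m j)) => B mB.
have mLB : measurable (L m @^-1` B) by rewrite -[X in measurable X]setTI; exact: mL.
by have [_] := past_indep mX indX ij sA mLB.
Qed.

(** The future steps are centred and independent of [A]. *)
Lemma future_integral i m A (c b : R) (s : seq 'I_n) : <<s past_events X i >> A ->
  measurable A -> (forall j, j \in s -> (i <= j)%N) ->
  P.-integrable A (fun w => (c + b * \sum_(j <- s) L m (X j w))%:E) /\
  (\int[P]_(w in A) (c + b * \sum_(j <- s) L m (X j w))%:E = c%:E * P A)%E.
Proof.
move=> sA mA; elim: s => [|j s IH] sij.
  under eq_fun do rewrite big_nil mulr0 addr0.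
  split; first exact: finite_measure_integrable_cst.
  by rewrite integral_cst.
have [|IH1 IH2] := IH; first by move=> j' js; apply: sij; rewrite inE js orbT.
have iA : P.-integrable A (fun w => (b%:E * (L m (X j w))%:E)%E).
  by apply: integrableZl => //; exact: integrableS (iL m j).
have E w : ((c + b * \sum_(j0 <- j :: s) L m (X j0 w))%:E =
    (c + b * \sum_(j0 <- s) L m (X j0 w))%:E + b%:E * (L m (X j w))%:E)%E.
  by rewrite big_cons -EFinM -EFinD; congr EFin; ring.
under eq_fun do rewrite E; split; first exact: integrableD.
rewrite integralD//= IH2.
have iA' : P.-integrable A (fun w => (L m (X j w))%:E) by exact: integrableS (iL m j).
rewrite integralZl// (integral_past_eq0 _ sA) ?mule0 ?adde0//.
by apply: sij; rewrite mem_head.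
Qed.

Variables (c b y : R).
Hypotheses (c0 : 0 <= c) (b0 : 0 <= b).
Hypothesis hG : forall m w, ((c + b * (walk m n w - y))%:E <= G w)%E.

(** On an event of the first [i] steps that puts the walk above [y], the later
    steps average out, so the affine minorant of [G] integrates over [A] to at
    least [c] times the probability of [A]. *)
Lemma stopped_le i m A : <<s past_events X i >> A -> measurable A ->
  A `<=` [set w | y < walk m i w] -> (c%:E * P A <= \int[P]_(w in A) G w)%E.
Proof.
move=> sA mA Ay.
pose s := [seq j : 'I_n <- index_enum 'I_n | (i <= j)%N].
have [|iF eF] := @future_integral i m A c b s sA mA.
  by move=> j; rewrite mem_filter => /andP[].
rewrite -eF; pose F w := (c + b * \sum_(j <- s) L m (X j w))%:E.
have FG w : A w -> (F w <= G w)%E.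
  move=> Aw; apply: le_trans (hG m w); rewrite lee_fin lerD2l ler_wpM2l//.
  have -> : walk m n w = walk m i w + \sum_(j <- s) L m (X j w).
    rewrite /walk (eq_bigl predT); last by move=> j; rewrite ltn_ord.
    rewrite (bigID (fun j : 'I_n => (j < i)%N))/=; congr (_ + _).
    by rewrite /s big_filter; apply: eq_bigl => j; rewrite -leqNgt.
  by have := Ay _ Aw => /= ?; lra.
rewrite integralE; apply: (@le_trans _ _ (\int[P]_(w in A) (F^\+ w))%E).
  rewrite -[leRHS]sube0; apply: leeB => //; apply: integral_ge0 => w _.
  by rewrite funeneg.unlock le_max lexx orbT.
apply: ge0_le_integral => //.
- by apply: measurable_funepos; case/integrableP: iF.
- exact: measurable_funTS.
- by move=> w Aw; rewrite funepos.unlock ge_max FG//= G0.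
Qed.

Lemma disjoint_union_le (A : nat -> set Omega) : (forall k, measurable (A k)) ->
  trivIset setT A -> (forall k, c%:E * P (A k) <= \int[P]_(w in A k) G w)%E ->
  (c%:E * P (\bigcup_k A k) <= \int[P]_(w in \bigcup_k A k) G w)%E.
Proof.
move=> mA tA hA; rewrite measure_semi_bigcup//; last exact: bigcup_measurable.
rewrite ge0_integral_bigcup//; last exact: measurable_funTS.
rewrite -nneseriesZl//; apply: lee_nneseries => k _; last exact: hA.
by rewrite mule_ge0.
Qed.

(** Doob's maximal inequality for a countable family of walks driven by the same
    steps: the event is cut according to the first time [i] at which one of the
    walks exceeds [y], and then to the first walk [m] that does. *)
Theorem maximal_inequality :
  (c%:E * P (\bigcup_i \bigcup_m [set w | (y < walk m i w)%R]) <= \int[P]_w G w)%E.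
Proof.
pose F i m := [set w | y < walk m i w]; pose E i := \bigcup_m F i m.
have sub i i' m : (i <= i')%N -> <<s past_events X i' >> (F i m).
  move=> ii'.
  have : measurable_fun setT
      (fun w : g_sigma_algebraType (past_events X i') => walk m i w).
    under eq_fun do rewrite /walk big_mkcond.
    apply: measurable_sum => j.
    case ji : (j < i)%N; last exact: measurable_cst.
    exact: (past_measurable_fun (leq_trans ji ii') (mL m)).
  move=> /(_ measurableT _ (measurable_itv `]y, +oo[)); rewrite setTI.
  by congr (<<s _ >> _); apply/seteqP; split => w /=; rewrite in_itv/= andbT.
have subE i i' : (i <= i')%N -> <<s past_events X i' >> (E i).
  move=> ii'; rewrite -[<<s _ >>]/(@measurable _ (g_sigma_algebraType (past_events X i'))).
  by apply: bigcup_measurable => m _; exact: sub.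
have piece i m : <<s past_events X i >> (seqDU E i `&` seqDU (F i) m).
  rewrite -[<<s _ >>]/(@measurable _ (g_sigma_algebraType (past_events X i))).
  apply: measurableI; apply: measurableD.
  - exact: subE.
  - by apply: bigsetU_measurable => i' _; apply: subE; exact: ltnW.
  - exact: sub.
  - by apply: bigsetU_measurable => m' _; exact: sub.
have mF i m : measurable (F i m) by exact: measurable_walk_gt.
have mE i : measurable (E i) by exact: bigcup_measurable.
have mSE i : measurable (seqDU E i).
  by apply: measurableD => //; exact: bigsetU_measurable.
have mSF i m : measurable (seqDU (F i) m).
  by apply: measurableD => //; exact: bigsetU_measurable.
have hE i : (c%:E * P (seqDU E i) <= \int[P]_(w in seqDU E i) G w)%E.
  have -> : seqDU E i = \bigcup_m (seqDU E i `&` seqDU (F i) m).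
    rewrite -setI_bigcupr -seqDU_bigcup_eq setIidl//.
    by move=> w [].
  apply: disjoint_union_le.
  - by move=> m; exact: measurableI.
  - apply/trivIsetP => a a' _ _ ab.
    by rewrite setIACA (trivIsetP.1 (@trivIset_seqDU _ (F i)))// setI0.
  - move=> m; apply: (@stopped_le i m) => //; first exact: measurableI.
    by move=> w [_ []].
rewrite seqDU_bigcup_eq.
apply: (le_trans (disjoint_union_le mSE (@trivIset_seqDU _ E) hE)).
by apply: ge0_subset_integral => //; exact: bigcup_measurable.
Qed.

End MaximalInequality.

(** * Countable norming sets, lower integrals, scalar estimates *)

Section UnitSequence.
Context {R : realType} {k : scalar_kind} {H : hilbertSpace R k}.

(** The vectors with [<A u, u> > c |u|^2] form an open set, which meets a countable
    dense set; the inequality is homogeneous, so it survives normalization. *)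
Lemma separable_unit_seq : separable H -> (exists u : H, u != 0) ->
  exists v : nat -> H, (forall m, rnorm (v m) = 1) /\
    forall (A : H -> H) c u, linear A -> continuous A -> rnorm u = 1 ->
      c < rdot (A u) u -> exists m, c < rdot (A (v m)) (v m).
Proof.
move=> [D /countable_injP[g ginj] dD] [u0 u00].
pose v0 := sreal (rnorm u0)^-1 *: u0.
(* [g] is injective on [D], so [e] enumerates [D]; [v] replaces [0] by [v0]. *)
pose e m := xget v0 [set x | D x /\ g x = m].
pose v m := if e m == 0 then v0 else sreal (rnorm (e m))^-1 *: e m.
exists v; split.
  by move=> m; rewrite /v; case: eqVneq => h; apply: unit_vector.
move=> A c u lA cA u1 cu.
pose h x := rdot (A x) x - c * rdot x x.
have ch : continuous h.
  move=> x; apply: cvgB; first by apply: rdot_cvg2; [exact: cA|].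
  by apply: cvgM; [exact: cvg_cst|exact: rdot_cvg2].
have /continuousP ch' := ch.
have oh : open [set x | 0 < h x] by apply: (ch' [set x | 0 < x]); exact: open_gt.
have /(dD _)/(_ oh) [x [/= hx Dx]] : [set x | 0 < h x] !=set0.
  by exists u; rewrite /h /= rdotuu u1 expr1n mulr1 subr_gt0.
exists (g x); have ex : e (g x) = x.
  rewrite /e; case: xgetP => [y -> [Dy gy]|/(_ x)]; last by case.
  by apply: ginj => //; exact: mem_set.
have x0 : x != 0.
  apply: contraTneq hx => ->; rewrite /h linear_op0// !rdotuu rnorm0 expr0n/=.
  by rewrite mulr0 subrr ltxx.
rewrite /v ex (negbTE x0) rdot_rnormZ// exprVn mulrC ltr_pdivlMr ?exprn_gt0 ?rnorm_gt0//.
by move: hx; rewrite /h rdotuu subr_gt0.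
Qed.

End UnitSequence.

Section LowerIntegral.
Context d (Omega : measurableType d) (R : realType) (mu : {measure set Omega -> \bar R}).

(** The integral of a nonnegative function is a supremum over the simple functions
    below it, so it is monotone also for functions that are not measurable. *)
Lemma nonneg_integral_mono (f g : Omega -> \bar R) : (forall w, (0 <= f w)%E) ->
  (forall w, (f w <= g w)%E) -> (\int[mu]_w f w <= \int[mu]_w g w)%E.
Proof.
move=> f0 fg; have g0 w : (0 <= g w)%E by exact: le_trans (f0 w) (fg w).
rewrite !ge0_integralTE//; apply: ereal_sup_le => _ [h /= hf <-]; exists h => //=.
by move=> w; exact: le_trans (hf w) (fg w).
Qed.

End LowerIntegral.

Section RatioBounds.
Context {R : realType}.
Implicit Types (p F V E C D : R).

(** Either the claimed bound is at least [1 >= p], or the last hypothesis compares it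
    with the bound [D * (V - 1) / F]. *)
Lemma ratio_bound p F V E C D : 0 <= p <= 1 -> 0 < C -> 0 < E -> 1 <= V -> 1 <= D ->
  p * F <= D * (V - 1) -> (C * (V * E) < 1 -> V - 1 < C * (V * E) * F) ->
  p <= C * D * (V * E).
Proof.
move=> /andP[p0 p1] C0 E0 V1 D1 pF h.
have CVE : 0 < C * (V * E) by rewrite !mulr_gt0//; lra.
rewrite mulrAC; case: (lerP 1 (C * (V * E))) => [h1|/h h1].
  by apply: (le_trans p1); rewrite -[leLHS]mulr1 ler_pM//; lra.
have F0 : 0 < F by rewrite -(pmulr_rgt0 _ CVE); apply: le_lt_trans h1; rewrite subr_ge0.
rewrite -(ler_pM2r F0); apply: (le_trans pF).
have -> : C * (V * E) * D * F = D * (C * (V * E) * F) by ring.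
rewrite ler_pM2l; [exact: ltW|lra].
Qed.

(** With [C = e / (e - 1)], so that [C (1 - 1/e) = 1], and [u exp (- u) <= 1 / e]:
    [C V exp (- u) phi u = C V - C V u exp (- u) - C V exp (- u)
                        >= V - C V exp (- u) > V - 1]. *)
Lemma phi_ratio u V : 1 <= V ->
  expR 1 / (expR 1 - 1) * (V * expR (- u)) < 1 ->
  V - 1 < expR 1 / (expR 1 - 1) * (V * expR (- u)) * phi u.
Proof.
move=> V1; set C := _ / _ => h.
have e1 : 1 < expR 1 :> R by rewrite expR_gt1.
have CE : C * (1 - expR (- 1)) = 1.
  by rewrite /C expRN; field; rewrite !gt_eqF//; lra.
have C0 : 0 < C by rewrite divr_gt0 ?expR_gt0// subr_gt0.
have uE : u * expR (- u) <= expR (- 1).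
  have -> : expR (- 1) = expR (u - 1) * expR (- u) :> R by rewrite -expRD; congr expR; ring.
  by rewrite ler_pM2r ?expR_gt0//; have := expR_ge1Dx (u - 1); lra.
have EE : expR (- u) * expR u = 1 by rewrite -expRD addNr expR0.
have -> : C * (V * expR (- u)) * phi u =
  C * V * (expR (- u) * expR u) - C * V * (u * expR (- u)) - C * (V * expR (- u)).
  by rewrite /phi; ring.
have CV0 : 0 < C * V by rewrite mulr_gt0//; lra.
have h2 : C * V * (u * expR (- u)) <= C * V * expR (- 1) by rewrite ler_pM2l.
have h3 : C * V - C * V * expR (- 1) = V.
  by transitivity (C * (1 - expR (- 1)) * V); [ring|rewrite CE mul1r].
by rewrite EE; lra.
Qed.

(** Since [2 exp (- u) varphi u = 1 + exp (- 2 u) - 2 exp (- u)]. *)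
Lemma varphi_ratio u V : 1 <= V -> 2 * (V * expR (- u)) < 1 ->
  V - 1 < 2 * (V * expR (- u)) * varphi u.
Proof.
move=> V1 h.
have EE : expR (- u) * expR u = 1 by rewrite -expRD addNr expR0.
have -> : 2 * (V * expR (- u)) * varphi u =
  V * (expR (- u) * expR u) + V * expR (- u) ^+ 2 - 2 * (V * expR (- u)).
  by rewrite /varphi /cosh; field.
have : 0 <= V * expR (- u) ^+ 2 by rewrite mulr_ge0 ?sqr_ge0//; lra.
by rewrite EE; lra.
Qed.

End RatioBounds.

(** * Quadratic forms of the partial sums *)

Section OperatorWalk.
Context {R : realType} {k : scalar_kind} {H : hilbertSpace R k}.
Context {d : measure_display} {Omega : measurableType d} {P : probability Omega R}.
Context {n : nat} {X : 'I_n -> Omega -> H -> H}.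
Hypothesis randX : forall i, random_operator (X i).
Hypothesis indepX : independent_operators P X.
Hypothesis meanX : forall i, has_expectation P (X i) (fun=> 0).
Local Notation S := (partial_sum X).

Lemma compact_partial_sum i w : compact_selfadjoint (S i w).
Proof. by apply: compact_selfadjoint_sum => j; case: (randX j). Qed.

Lemma rdot_partial_sum i w u :
  rdot (S i w u) u = \sum_(j < n | (j < i)%N) rdot (X j w u) u.
Proof.
rewrite /partial_sum fct_sumE.
by apply: (big_morph (fun x => rdot x u)) => [x y|]; rewrite ?rdotDl ?rdot0l.
Qed.

Variables (sg : nat -> R) (v : nat -> H).

(** With [sg = 1] these functionals have supremum [lambda_max]; with both signs for
    each vector, their supremum is [opnorm]. Their domain is the space of operators
    equipped with the sigma-algebra [op_borel]. *)
Definition form_functional m (A : g_sigma_algebraType (@op_open R k H)) : R :=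
  sg m * rdot (A (v m)) (v m).

Let X' : 'I_n -> Omega -> g_sigma_algebraType (@op_open R k H) := X.

Lemma walk_form m i w : walk X' form_functional m i w = sg m * rdot (S i w (v m)) (v m).
Proof. by rewrite /walk -mulr_sumr rdot_partial_sum. Qed.

Let mX j : measurable_fun setT (X' j).
Proof. by move=> _ B mB; rewrite setTI; case: (randX j) => _; apply. Qed.

Let mL m : measurable_fun setT (form_functional m).
Proof. by apply: measurable_funM; [exact: measurable_cst|exact: measurable_form]. Qed.

Let LE m j w : (form_functional m (X' j w))%:E =
  ((sg m)%:E * (sre (inner H (X j w (v m)) (v m)))%:E)%E.
Proof. by []. Qed.

Let iL m j : P.-integrable setT (fun w => (form_functional m (X' j w))%:E).
Proof.
have [iX _ _ _] := meanX j (v m) (v m).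
by under eq_fun do rewrite LE; exact: integrableZl.
Qed.

Let L0 m j : (\int[P]_w (form_functional m (X' j w))%:E = 0)%E.
Proof.
have [iX _ X0 _] := meanX j (v m) (v m).
under eq_integral do rewrite LE.
by rewrite integralZl// X0 [inner H _ _]linear0l sre0 mule0.
Qed.

Definition sup_event (Phi : (H -> H) -> R) r := [set w : Omega |
  (r%:E <= ereal_sup [set (Phi (S i w))%:E | i in [set i : nat | (1 <= i <= n)%N]])%E].

Variable Phi : (H -> H) -> R.
Hypothesis PhiE : forall A, compact_selfadjoint A ->
  forall c, c < Phi A <-> exists m, c < sg m * rdot (A (v m)) (v m).

(** All levels [y < r] are considered because the supremum defining [Phi] need not be
    attained by the countable family of vectors. *)
Lemma sup_event_exceed r w : sup_event Phi r w <-> forall y, y < r ->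
  exists i m, (1 <= i <= n)%N /\ y < walk X' form_functional m i w.
Proof.
split=> [h y yr|h].
  have : (y%:E < ereal_sup [set (Phi (S i w))%:E |
      i in [set i : nat | (1 <= i <= n)%N]])%E by apply: lt_le_trans h; rewrite lte_fin.
  move=> /ereal_sup_gt[_ [i /= hi <-]]; rewrite lte_fin.
  move=> /(PhiE (compact_partial_sum i w))[m hm]; exists i, m; split => //.
  by rewrite walk_form.
apply/lee_subgt0Pr => e e0; have [|i [m [hi hm]]] := h (r - e).
  by rewrite ltrBlDr ltrDl.
rewrite -EFinB; apply: (@le_trans _ _ (Phi (S i w))%:E).
  rewrite lee_fin ltW//; apply/(PhiE (compact_partial_sum i w)).
  by exists m; rewrite -walk_form.
by apply: ereal_sup_ubound; exists i.
Qed.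

Lemma measurable_sup_event r : measurable (sup_event Phi r).
Proof.
have -> : sup_event Phi r = \bigcap_(q : nat) \bigcup_(i in [set i : nat | (1 <= i <= n)%N])
    \bigcup_m [set w | r - q.+1%:R^-1 < walk X' form_functional m i w].
  apply/seteqP; split => [w /sup_event_exceed h q _|w h].
    have [|i [m [hi hm]]] := h (r - q.+1%:R^-1); first by rewrite ltrBlDr ltrDl invr_gt0.
    by exists i => //; exists m.
  apply/sup_event_exceed => y yr; have ry : 0 < r - y by rewrite subr_gt0.
  have [q hq] : exists q : nat, q.+1%:R^-1 < r - y.
    exists (Num.bound (r - y)^-1); rewrite invf_plt ?posrE//.
    apply: (lt_le_trans (archi_boundP _)); first by rewrite invr_ge0 ltW.
    by rewrite ler_nat.
  have [i hi [m _ hm]] := h q I; exists i, m; split => //.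
  by apply: lt_trans hm; rewrite ltrBrDr -ltrBrDl.
apply: bigcap_measurableType => q _; apply: bigcup_measurable => i _.
by apply: bigcup_measurable => m _; exact: (measurable_walk_gt iL).
Qed.

(** The maximal inequality at a level [y < r], with the tangent line of [f] at
    [theta * y] as affine minorant; then [y] tends to [r]. *)
Lemma sup_event_moment (f : R -> R) (G : Omega -> \bar R) theta r (M : R) :
  0 <= theta -> 0 < r ->
  (forall x, 0 <= f x) ->
  (forall y, 0 <= y -> exists2 b, 0 <= b & forall x, f y + b * (x - y) <= f x) ->
  measurable_fun setT G -> (forall w, (0 <= G w)%E) ->
  (forall m w, ((f (theta * (sg m * rdot (S n w (v m)) (v m))))%:E <= G w)%E) ->
  (\int[P]_w G w <= M%:E)%E ->
  fine (P (sup_event Phi r)) * f (theta * r) <= M.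
Proof.
move=> t0 r0 f0 ft mG G0 hG GM; set E := sup_event Phi r.
have mE : measurable E by exact: measurable_sup_event.
have PE : P E = (fine (P E))%:E by rewrite fineK// fin_num_measure.
have p0 : 0 <= fine (P E) by rewrite fine_ge0.
have p1 : fine (P E) <= 1 by rewrite -lee_fin -PE probability_le1.
have main y : 0 <= y -> y < r -> fine (P E) * f (theta * y) <= M.
  move=> y0 yr; have [b b0 hb] := ft (theta * y) (mulr_ge0 t0 y0).
  pose U := \bigcup_i \bigcup_m [set w | y < walk X' form_functional m i w].
  have hm : ((f (theta * y))%:E * P U <= \int[P]_w G w)%E.
    apply: (maximal_inequality mX indepX mL iL L0 mG G0 (b := theta * b)) => //.
      exact: mulr_ge0.
    move=> m w; apply: le_trans (hG m w); rewrite lee_fin walk_form.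
    apply: le_trans (hb _); rewrite lerD2l le_eqVlt; apply/orP; left; apply/eqP; ring.
  have mU : measurable U.
    apply: bigcup_measurable => i _; apply: bigcup_measurable => m _.
    exact: (measurable_walk_gt iL).
  have EU : (P E <= P U)%E.
    apply: le_measure; rewrite ?inE// => w /sup_event_exceed/(_ _ yr)[i [m [_ h]]].
    by exists i => //; exists m.
  rewrite -lee_fin mulrC EFinM -PE; apply: le_trans GM; apply: le_trans hm.
  by rewrite lee_wpmul2l// lee_fin.
have [b b0 hb] := ft (theta * r) (mulr_ge0 t0 (ltW r0)).
apply/ler_addgt0Pr => e e0.
have b1 : 0 < theta * b + 1 by rewrite ltr_wpDl// mulr_ge0.
pose y := Num.max 0 (r - e / (theta * b + 1)).
have y0 : 0 <= y by rewrite le_max lexx.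
have yr : y < r by rewrite gt_max r0/= ltrBlDr ltrDl divr_gt0.
have h1 := main y y0 yr; have h2 := hb (theta * y).
have h3 : theta * b * (r - y) <= e.
  apply: (@le_trans _ _ ((theta * b) * (e / (theta * b + 1)))).
    rewrite ler_wpM2l ?mulr_ge0// lerBlDr -lerBlDl le_max lexx orbT//.
  by rewrite mulrCA ger_pMr// ler_pdivrMr ?mul1r ?lerDl.
have h4 : fine (P E) * (theta * b * (r - y)) <= e.
  apply: le_trans h3; rewrite -[leRHS]mul1r ler_wpM2r//.
  by rewrite !mulr_ge0// subr_ge0 ltW.
have h5 : f (theta * r) - theta * b * (r - y) <= f (theta * y).
  by apply: le_trans h2; rewrite le_eqVlt; apply/orP; left; apply/eqP; ring.
have h6 := ler_wpM2l p0 h5; lra.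
Qed.

Lemma measurable_form_walk (f : R -> R) theta m : measurable_fun setT f ->
  measurable_fun setT (fun w => f (theta * rdot (S n w (v m)) (v m))).
Proof.
move=> mf; apply: measurableT_comp => //; apply: measurable_funM => //.
under eq_fun do rewrite rdot_partial_sum big_mkcond.
apply: measurable_sum => j; case ji : (j < n)%N => //.
exact: (measurableT_comp (measurable_form (v m)) (mX j)).
Qed.

(** The supremum of the values of [f] at the forms of the unit vectors [v m] is a
    measurable minorant of the trace, which can be fed to the maximal
    inequality. *)
Lemma trace_minorant (f : R -> R) theta : (forall m, rnorm (v m) = 1) ->
  measurable_fun setT f -> (forall x, 0 <= f x) ->
  (forall y, exists b, forall x, f y + b * (x - y) <= f x) ->
  (forall A : H -> H, compact_selfadjoint A -> exists B, spectral_fun f A B) ->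
  exists G : Omega -> \bar R, [/\ measurable_fun setT G, forall w, (0 <= G w)%E,
    forall m w, ((f (theta * rdot (S n w (v m)) (v m)))%:E <= G w)%E &
    (\int[P]_w G w <= \int[P]_w optrace (opfun f (sreal theta *: S n w)))%E].
Proof.
move=> v1 mf f0 ft fB.
pose g m w := (f (theta * rdot (S n w (v m)) (v m)))%:E.
pose G w := esups (g^~ w) 0%N.
have gG m w : (g m w <= G w)%E by apply: ereal_sup_ubound; exists m.
have G0 w : (0 <= G w)%E by apply: le_trans (gG 0%N w); rewrite lee_fin.
exists G; split => //.
  by apply: measurable_fun_esups => m; apply/measurable_EFinP; exact: measurable_form_walk.
apply: nonneg_integral_mono => // w; apply: ge_ereal_sup => _ [m _ <-].
have cA := compact_selfadjointZ theta (compact_partial_sum n w).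
apply: le_trans (optrace_ge cA (fB _ cA) f0 ft (v1 m)).
by rewrite /g lee_fin !fctE rdotZl.
Qed.

End OperatorWalk.

(** * The tail bounds *)

Section Functions.
Context {R : realType} {k : scalar_kind} {H : hilbertSpace R k}.

Lemma spectral_fun_phi (A : H -> H) : compact_selfadjoint A ->
  exists B, spectral_fun phi A B.
Proof.
move=> cA; have [B hB] := spectral_fun_exp 1 0 (-1) (-1) cA; exists B.
by have -> : phi = (fun x => 1 * expR x + 0 * expR (- x) + -1 * x + -1) :> (R -> R);
  [apply/funext => x; rewrite /phi; ring|exact: hB].
Qed.

Lemma spectral_fun_varphi (A : H -> H) : compact_selfadjoint A ->
  exists B, spectral_fun varphi A B.
Proof.
move=> cA; have [B hB] := spectral_fun_exp (2^-1) (2^-1) 0 (-1) cA; exists B.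
have -> : varphi = (fun x => 2^-1 * expR x + 2^-1 * expR (- x) + 0 * x + -1) :> (R -> R).
  by apply/funext => x; rewrite /varphi /cosh; field.
exact: hB.
Qed.

End Functions.

Section TailBound.
Context {d : measure_display} {Omega : measurableType d} {R : realType}.
Variable P : probability Omega R.

(** The moment bound at each [theta] becomes an exponential bound by [ratio_bound];
    the infimum is taken afterwards. For [r = 0] the moment bound is
    [p f 0 <= D (V - 1)], which holds as [f 0 = 0]. *)
Lemma tail_bound (E : set Omega) (f psi : R -> R) (K D sigma r : R) (thmax : \bar R) :
  measurable E -> (0 < thmax)%E -> 0 < K -> 1 <= D -> 0 <= r -> f 0 = 0 ->
  (forall u V, 1 <= V -> K * (V * expR (- u)) < 1 -> V - 1 < K * (V * expR (- u)) * f u) ->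
  (forall theta, cgf_dom thmax theta -> 1 <= expR (psi theta * sigma ^+ 2)) ->
  (forall theta, cgf_dom thmax theta -> 0 < r ->
    fine (P E) * f (theta * r) <= D * (expR (psi theta * sigma ^+ 2) - 1)) ->
  (P E <= (K * D * inf [set expR (psi theta * sigma ^+ 2 - theta * r) |
    theta in cgf_dom thmax])%:E)%E.
Proof.
move=> mE th0 K0 D1 r0 f00 ratio V1 moment.
have PE : P E = (fine (P E))%:E by rewrite fineK// fin_num_measure.
have p01 : 0 <= fine (P E) <= 1.
  by rewrite fine_ge0//= -lee_fin -PE probability_le1.
have KD : 0 < K * D by rewrite mulr_gt0//; lra.
rewrite PE lee_fin -ler_pdivrMl//; apply: lb_le_inf.
  by eexists; exists 0 => //; split.
move=> _ [theta dom <-]; rewrite ler_pdivrMl// expRD.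
apply: (ratio_bound (F := f (theta * r)) p01 K0 (expR_gt0 _) (V1 _ dom) D1).
  move: r0; rewrite le_eqVlt => /predU1P[<-|r0]; last exact: moment.
  by rewrite mulr0 f00 mulr0 mulr_ge0 ?subr_ge0 ?V1//; lra.
exact: ratio (V1 _ dom).
Qed.

End TailBound.

Section ZeroSpace.
Context {R : realType} {k : scalar_kind} {H : hilbertSpace R k}.
Context {d : measure_display} {Omega : measurableType d} {n : nat}.
Variable X : 'I_n -> Omega -> H -> H.
Variable Phi : (H -> H) -> R.
Hypothesis Phi0 : forall A, Phi A = 0.

(** On the zero space [lambda_max] and [opnorm] vanish, which no family of unit
    vectors can witness; the event is then empty or full. *)
Lemma sup_event_zero r : sup_event (X := X) Phi r = set0 \/
  r <= 0 /\ sup_event (X := X) Phi r = setT.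
Proof.
have [[i hi]|n0] := pselect (exists i, (1 <= i <= n)%N); last first.
  left; rewrite -subset0 => w /=.
  rewrite /sup_event/= (_ : [set _ | _ in _] = set0) ?ereal_sup0//.
  by rewrite -subset0 => x [i hi _]; apply: n0; exists i.
have E w : [set (Phi (partial_sum X i w))%:E |
    i in [set i : nat | (1 <= i <= n)%N]] = [set 0%E].
  apply/seteqP; split => [_ [j _ <-]|_ ->]; first by rewrite Phi0.
  by exists i => //; rewrite Phi0.
have [r0|r0] := leP r 0; [right; split => //|left].
  by rewrite -subTset => w _; rewrite /sup_event/= E ereal_sup1 lee_fin.
rewrite -subset0 => w; rewrite /sup_event/= E ereal_sup1 lee_fin.
by move=> /(lt_le_trans r0); rewrite ltxx.
Qed.

Lemma measurable_sup_event_zero r : measurable (sup_event (X := X) Phi r).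
Proof. by have [->|[_ ->]] := sup_event_zero r. Qed.

Lemma sup_event_zero_pos r : 0 < r -> sup_event (X := X) Phi r = set0.
Proof. by move=> r0; have [//|[/le_lt_trans/(_ r0)]] := sup_event_zero r; rewrite ltxx. Qed.

End ZeroSpace.

Section TraceCgf.
Context {R : realType} {k : scalar_kind} {H : hilbertSpace R k}.
Context {d : measure_display} {Omega : measurableType d} {P : probability Omega R}.

Lemma trace_cgf_boundE (f psi : R -> R) (sigma D theta : R) (S : Omega -> H -> H) :
  trace_cgf_bound P f psi sigma D S theta <->
  (\int[P]_w optrace (opfun f (sreal theta *: S w)) <=
    (D * (expR (psi `|theta| * sigma ^+ 2) - 1))%:E)%E.
Proof.
by rewrite /trace_cgf_bound -leeBrDr// -EFinB mulrBr mulr1.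
Qed.

Lemma trace_cgf_bound_ge0 (f psi : R -> R) (sigma D theta : R) (S : Omega -> H -> H) :
  (forall w, compact_selfadjoint (S w)) -> (forall x, 0 <= f x) ->
  (forall A : H -> H, compact_selfadjoint A -> exists B, spectral_fun f A B) ->
  trace_cgf_bound P f psi sigma D S theta ->
  0 <= D * (expR (psi `|theta| * sigma ^+ 2) - 1).
Proof.
move=> cS f0 fB /trace_cgf_boundE h; rewrite -lee_fin; apply: le_trans h.
apply: integral_ge0 => w _; have cA := compact_selfadjointZ theta (cS w).
exact: optrace_ge0 cA (fB _ cA) f0.
Qed.

End TraceCgf.

Section Moments.
Context {R : realType} {k : scalar_kind} {H : hilbertSpace R k}.
Hypothesis sepH : separable H.
Context {d : measure_display} {Omega : measurableType d} {P : probability Omega R}.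
Context {n : nat} {X : 'I_n -> Omega -> H -> H}.
Hypothesis randX : forall i, random_operator (X i).
Hypothesis indepX : independent_operators P X.
Hypothesis meanX : forall i, has_expectation P (X i) (fun=> 0).
Local Notation S := (partial_sum X).
Variables (psi : R -> R) (sigma D r : R).
Local Notation cgf := (trace_cgf_bound P).
Local Notation M theta := (D * (expR (psi theta * sigma ^+ 2) - 1)).

Lemma lambda_max_moment : measurable (sup_event (X := X) lambda_max r) /\
  forall theta, 0 <= theta -> cgf phi psi sigma D (S n) theta -> 0 < r ->
    fine (P (sup_event (X := X) lambda_max r)) * phi (theta * r) <= M theta.
Proof.
have [Hn0|H0] := pselect (exists u : H, u != 0); last first.
  have {}H0 (u : H) : u = 0 by apply/eqP/negP => /negP u0; apply: H0; exists u.
  have z := lambda_max_zero_space H0; split; first exact: measurable_sup_event_zero.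
  move=> theta t0 tr r0; rewrite sup_event_zero_pos// measure0 mul0r.
  have := trace_cgf_bound_ge0 (compact_partial_sum randX n) (@phi_ge0 R) spectral_fun_phi tr.
  by rewrite ger0_norm.
have [v [v1 vd]] := separable_unit_seq sepH Hn0.
have PhiE (A : H -> H) : compact_selfadjoint A -> forall c, c < lambda_max A <->
    exists m, c < (fun=> 1) m * rdot (A (v m)) (v m).
  move=> cA c; have lA := compact_selfadjoint_linear cA.
  have [K K0 bA] := compact_opbound cA.
  rewrite (lambda_max_gt c lA (compact_selfadjoint_rdot cA) bA K0 Hn0).
  split=> [[u u1 cu]|[m hm]].
    have [m hm] := vd A c u lA (opbound_continuous lA bA) u1 cu.
    by exists m; rewrite mul1r.
  by exists (v m) => //; rewrite mul1r in hm.
split; first exact: (measurable_sup_event (sg := fun=> 1) (v := v) randX meanX PhiE).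
move=> theta t0 /trace_cgf_boundE; rewrite ger0_norm// => tr r0.
have phi_t (y : R) : exists b, forall x, phi y + b * (x - y) <= phi x.
  by eexists; exact: phi_tangent.
have [G [mG G0 hG GF]] := @trace_minorant _ _ _ _ _ P _ _ randX v phi theta v1
  measurable_phi (@phi_ge0 R) phi_t spectral_fun_phi.
apply: (sup_event_moment (sg := fun=> 1) (v := v) (G := G) randX indepX meanX PhiE) => //.
- exact: phi_ge0.
- exact: tangent_phi_ge0.
- by move=> m w; rewrite mul1r; exact: hG.
- exact: le_trans GF tr.
Qed.

(** Under the first alternative, the average of the minorants of the traces at [theta]
    and [- theta] is a minorant for [varphi]. *)
Lemma opnorm_moment : measurable (sup_event (X := X) opnorm r) /\
  forall theta, 0 <= theta ->
    (cgf phi psi sigma D (S n) theta /\ cgf phi psi sigma D (S n) (- theta)) \/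
    cgf varphi psi sigma D (S n) theta -> 0 < r ->
    fine (P (sup_event (X := X) opnorm r)) * varphi (theta * r) <= M theta.
Proof.
have [Hn0|H0] := pselect (exists u : H, u != 0); last first.
  have {}H0 (u : H) : u = 0 by apply/eqP/negP => /negP u0; apply: H0; exists u.
  have z := opnorm_zero_space H0; split; first exact: measurable_sup_event_zero.
  move=> theta t0 tr r0; rewrite sup_event_zero_pos// measure0 mul0r.
  rewrite -(ger0_norm t0); case: tr => [[tr _]|tr].
    exact: trace_cgf_bound_ge0 (compact_partial_sum randX n) (@phi_ge0 R) spectral_fun_phi tr.
  exact: trace_cgf_bound_ge0 (compact_partial_sum randX n) (@varphi_ge0 R) spectral_fun_varphi tr.
have [u [u1 ud]] := separable_unit_seq sepH Hn0.
(* Each vector occurs twice, at the even index with sign [+] and at the odd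
   index with sign [-]. *)
pose v m := u m./2; have v1 m : rnorm (v m) = 1 by exact: u1.
have PhiE (A : H -> H) : compact_selfadjoint A -> forall c, c < opnorm A <->
    exists m, c < (-1) ^+ m * rdot (A (v m)) (v m).
  move=> cA c; have lA := compact_selfadjoint_linear cA.
  have [K K0 bA] := compact_opbound cA.
  rewrite (opnorm_gt c lA (compact_selfadjoint_rdot cA) bA K0 Hn0).
  split=> [[x x1]|[m hm]]; last first.
    exists (v m) => //; apply: (lt_le_trans hm); apply: le_trans (ler_norm _) _.
    by rewrite normrM normrX normrN1 expr1n mul1r.
  case: (ger0P (rdot (A x) x)) => _ cx.
    have [m hm] := ud A c x lA (opbound_continuous lA bA) x1 cx.
    exists m.*2; rewrite /v doubleK -muln2 mulnC exprM sqrrN expr1n expr1n mul1r//.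
  pose NA y := - A y.
  have lN : linear NA by move=> z y y'; rewrite /NA lA opprD scalerN.
  have bN : opbound NA K by move=> y; rewrite /NA rnormN.
  have cx' : c < rdot (NA x) x by rewrite rdotNl.
  have [m hm] := ud NA c x lN (opbound_continuous lN bN) x1 cx'.
  exists m.*2.+1; rewrite /v -[m.*2.+1./2]/(uphalf m.*2) uphalf_double.
  rewrite exprS -muln2 mulnC exprM sqrrN expr1n expr1n mulr1 mulN1r.
  by rewrite -rdotNl.
split; first exact: (measurable_sup_event randX meanX PhiE).
move=> theta t0 tr r0.
have [G [mG G0 hG GM]] : exists G : Omega -> \bar R, [/\ measurable_fun setT G,
    forall w, (0 <= G w)%E,
    forall m w, ((varphi (theta * rdot (S n w (v m)) (v m)))%:E <= G w)%E &
    (\int[P]_w G w <= (M theta)%:E)%E].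
  have phi_t (y : R) : exists b, forall x, phi y + b * (x - y) <= phi x.
    by eexists; exact: phi_tangent.
  have varphi_t (y : R) : exists b, forall x, varphi y + b * (x - y) <= varphi x.
    by eexists; exact: varphi_tangent.
  have minor f := @trace_minorant _ _ _ _ _ P _ _ randX v f.
  case: tr => [[/trace_cgf_boundE tr1 /trace_cgf_boundE tr2]|/trace_cgf_boundE tr].
    rewrite normrN in tr2; rewrite ger0_norm// in tr1 tr2.
    have [G1 [mG1 G10 hG1 GF1]] := minor phi theta v1 measurable_phi (@phi_ge0 R)
      phi_t spectral_fun_phi.
    have [G2 [mG2 G20 hG2 GF2]] := minor phi (- theta) v1 measurable_phi (@phi_ge0 R)
      phi_t spectral_fun_phi.
    exists (fun w => (2^-1)%:E * (G1 w + G2 w))%E; split.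
    - exact: measurable_funeM (emeasurable_funD mG1 mG2).
    - by move=> w; rewrite mule_ge0 ?adde_ge0// lee_fin invr_ge0.
    - move=> m w; rewrite varphiE mulrC EFinM EFinD lee_pmul2l ?lte_fin ?invr_gt0//.
      by rewrite leeD// -mulNr hG2.
    have mG12 : measurable_fun setT (fun w => G1 w + G2 w)%E by exact: emeasurable_funD.
    have G120 w : setT w -> (0 <= G1 w + G2 w)%E by move=> _; rewrite adde_ge0.
    have half0 : (0 <= (2^-1 : R)%:E)%E by rewrite lee_fin invr_ge0.
    rewrite (ge0_integralZl _ measurableT mG12 G120 half0)// ge0_integralD//.
    apply: (@le_trans _ _ ((2^-1)%:E * ((M theta)%:E + (M theta)%:E))%E).
      rewrite lee_pmul2l ?lte_fin ?invr_gt0//.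
      by rewrite leeD//; [exact: le_trans GF1 tr1|exact: le_trans GF2 tr2].
    by rewrite -EFinD -EFinM lee_fin le_eqVlt; apply/orP; left; apply/eqP; field.
  rewrite ger0_norm// in tr.
  have [G [mG G0 hG GF]] := minor varphi theta v1 measurable_varphi (@varphi_ge0 R)
    varphi_t spectral_fun_varphi.
  by exists G; split => //; exact: le_trans GF tr.
apply: (sup_event_moment (sg := fun m => (-1) ^+ m) (v := v) (G := G)
  randX indepX meanX PhiE) => //.
- exact: varphi_ge0.
- exact: tangent_varphi_ge0.
- by move=> m w; rewrite mulrCA varphi_sign; exact: hG.
Qed.

End Moments.

Theorem theorem4p1 (R : realType) (k : scalar_kind) (H : hilbertSpace R k)
    (sepH : separable H)
    (d : measure_display) (Omega : measurableType d) (P : probability Omega R)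
    (n : nat) (X : 'I_n -> Omega -> H -> H)
    (randX : forall i, random_operator (X i))
    (indepX : independent_operators P X)
    (meanX : forall i, has_expectation P (X i) (fun=> 0))
    (thmax : \bar R) (psi : R -> R) (cgf : CGF_like thmax psi)
    (sigma d' r : R) (sigma0 : 0 < sigma) (d1 : 1 <= d') (r0 : 0 <= r) :
  let S := partial_sum X in
  let bound := inf [set expR (psi theta * sigma ^+ 2 - theta * r)
                   | theta in cgf_dom thmax] in
  ((forall theta : R, 0 <= theta -> (theta%:E < thmax)%E ->
      trace_cgf_bound P phi psi sigma d' (S n) theta) ->
   (P [set w | r%:E <= ereal_sup [set (lambda_max (S i w))%:E
                                  | i in [set i : nat | (1 <= i <= n)%N]]]
      <= (expR 1 / (expR 1 - 1) * d' * bound)%:E)%E)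
  /\
  ((forall theta : R, (- thmax < theta%:E)%E -> (theta%:E < thmax)%E ->
      trace_cgf_bound P phi psi sigma d' (S n) theta) \/
   (forall theta : R, (- thmax < theta%:E)%E -> (theta%:E < thmax)%E ->
      trace_cgf_bound P varphi psi sigma d' (S n) theta) ->
   (P [set w | r%:E <= ereal_sup [set (opnorm (S i w))%:E
                                  | i in [set i : nat | (1 <= i <= n)%N]]]
      <= (2 * d' * bound)%:E)%E).
Proof.
move=> S bound; rewrite /bound /S {S bound}.
have [th0 _ _ _] := cgf; have d'0 : 0 < d' by lra.
have cS w : compact_selfadjoint (partial_sum X n w) by exact: compact_partial_sum.
have phi0 : phi 0 = 0 :> R by rewrite /phi expR0; ring.
have varphi0 : varphi 0 = 0 :> R by rewrite varphiE oppr0 phi0 addr0 mul0r.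
have V1 theta f : 0 <= theta -> (forall x : R, 0 <= f x) ->
    (forall A : H -> H, compact_selfadjoint A -> exists B, spectral_fun f A B) ->
    trace_cgf_bound P f psi sigma d' (partial_sum X n) theta ->
    1 <= expR (psi theta * sigma ^+ 2).
  move=> t0 f0 fB /(trace_cgf_bound_ge0 cS f0 fB).
  by rewrite pmulr_rge0// subr_ge0 ger0_norm.
have e1 : 1 < expR 1 :> R by rewrite expR_gt1.
split=> [cgfa|cgfb].
  have [mE moment] := lambda_max_moment sepH randX indepX meanX psi sigma d' r.
  have K0 : 0 < expR 1 / (expR 1 - 1) :> R by rewrite divr_gt0 ?expR_gt0// subr_gt0.
  apply: (tail_bound mE th0 K0 d1 r0 phi0).
  - exact: phi_ratio.
  - move=> theta [t0 tm]; apply: (V1 _ _ t0 (@phi_ge0 R) spectral_fun_phi).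
    exact: cgfa.
  - by move=> theta [t0 tm]; apply: moment => //; exact: cgfa.
have lower theta : 0 <= theta -> (- thmax < theta%:E)%E.
  by move=> t0; apply: (@lt_le_trans _ _ 0%E); rewrite ?lee_fin// oppe_lt0.
have upper theta : (theta%:E < thmax)%E -> (- thmax < (- theta)%:E)%E.
  by rewrite EFinN lteN2.
have lower' theta : 0 <= theta -> ((- theta)%:E < thmax)%E.
  by move=> t0; apply: le_lt_trans th0; rewrite lee_fin oppr_le0.
have [mE moment] := opnorm_moment sepH randX indepX meanX psi sigma d' r.
apply: (tail_bound mE th0 (ltr0Sn R 1) d1 r0 varphi0).
- exact: varphi_ratio.
- move=> theta [t0 tm]; case: cgfb => cgfb.
    by apply: (V1 _ _ t0 (@phi_ge0 R) spectral_fun_phi); apply: cgfb; rewrite ?lower.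
  by apply: (V1 _ _ t0 (@varphi_ge0 R) spectral_fun_varphi); apply: cgfb; rewrite ?lower.
- move=> theta [t0 tm]; apply: moment => //; case: cgfb => cgfb; [left|right].
    by split; apply: cgfb => //; [exact: lower|exact: upper|exact: lower'].
  by apply: cgfb; rewrite ?lower.
Qed.
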